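(* Let $G$ be a finite group and let $L$ be a $G$-Galois extension of a field $K$. Then the map of $G$-Tambara functors $$\underline{K} \rightarrow \mathrm{FP}(L)$$ is formally étale. If $\underline{K}$ satisfies the Hilbert basis theorem, then it is étale.
   Context: Mackey, (commutative) Green and Tambara functors for a finite group $G$ have their standard meaning: a $G$-Tambara functor $k$ has commutative rings $k(X)$ for finite $G$-sets $X$, with restrictions $\mathrm{Res}$, transfers $\mathrm{Tr}$ and norms $\mathrm{Nm}$. A module over a Tambara functor is a module over its underlying Green functor. A $k$-algebra is a Tambara functor $R$ with a morphism $k \to R$. $\boxtimes_k$ is the relative box product over $k$. For a ring $S$ with $G$-action, $\mathrm{FP}(S)$ is the fixed-point Tambara functor, $\mathrm{FP}(S)(G/H) = S^H$, with restrictions the inclusions and transfers and norms given by sums and products over cosets. $\underline{K}$ is the constant Tambara functor, i.e. $\mathrm{FP}(K)$ with trivial action. The map $\underline{K} \to \mathrm{FP}(L)$ is induced by the inclusion $K \subset L$. Étale. A $k$-module $M$ is flat if $M \boxtimes_k -$ is exact on $k$-modules. The free polynomial $k$-algebra on a generator in level $X$ ($X$ a finite $G$-set) is the $k$-algebra representing $R \mapsto R(X)$. A $k$-algebra is finitely presented if it is the coequalizer of a pair of maps between free polynomial $k$-algebras on finitely many generators. A Tambara ideal is the (levelwise) kernel of a morphism of Tambara functors. For a Tambara ideal $I$, $I^{>1}$ is the sub-ideal of $I$ generated by all nontrivial norms (including products) of elements of $I$: in level $G/H$ by $I(G/H)^2$ together with the images of all norms $I(G/K') \to I(G/H)$ for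 $K'$ conjugate to a proper subgroup of $H$. For a $k$-algebra $R$ with $I = \ker(R \boxtimes_k R \to R)$ (multiplication), the genuine Kähler differentials are $\Omega^{1,\mathrm{Tamb}}_{R/k} := I/I^{>1}$. A morphism $k \to R$ is formally étale if $R$ is flat as a $k$-module and $\Omega^{1,\mathrm{Tamb}}_{R/k} = 0$; it is étale if it is moreover finitely presented. A Tambara functor $k$ satisfies the Hilbert basis theorem if every (Tambara) ideal of every free polynomial $k$-algebra on finitely many generators is finitely generated. *)

(* Defs.v *)
From HB Require Import structures.
From mathcomp Require Import all_boot all_order all_fingroup all_algebra.
From mathcomp Require Import falgebra fieldext galois.

Set Implicit Arguments.
Unset Strict Implicit.
Unset Printing Implicit Defensive.

Import GRing.Theory.
Local Open Scope ring_scope.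

(* Finite G-sets, G being the whole of gT.  As everywhere in MathComp, actions
   are right actions; this includes that of a Galois group on its field, see
   [galM].  Left and right actions correspond to each other by inversion. *)
Record gset (gT : finGroupType) := GSet {
  gset_car :> finType;
  gact : {action gT &-> gset_car} }.

Record gmap (gT : finGroupType) (X Y : gset gT) := GMap {
  gmap_fun :> X -> Y;
  gmapJ : forall x a, gmap_fun (gact X x a) = gact Y (gmap_fun x) a }.

Definition gid (gT : finGroupType) (X : gset gT) : gmap X X :=
  GMap (fun x a => erefl (gact X x a)).

Lemma gcomp_subproof (gT : finGroupType) (X Y Z : gset gT)
    (g : gmap Y Z) (f : gmap X Y) x a :
  g (f (gact X x a)) = gact Z (g (f x)) a.
Proof. by rewrite !gmapJ. Qed.

Definition gcomp (gT : finGroupType) (X Y Z : gset gT)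
  (g : gmap Y Z) (f : gmap X Y) : gmap X Z := GMap (gcomp_subproof g f).

Definition is_orbit (gT : finGroupType) (X : gset gT) : bool :=
  [transitive [set: gT], on [set: X] | gact X].

Record is_pullback (gT : finGroupType) (W X Y Z : gset gT)
    (p : gmap W X) (q : gmap W Y) (f : gmap X Z) (g : gmap Y Z) : Prop := {
  pullback_comm : forall w, f (p w) = g (q w);
  pullback_univ : forall x y, f x = g y -> exists! w, p w = x /\ q w = y }.

Definition is_coprod (gT : finGroupType) (X Y Z : gset gT)
    (i : gmap X Z) (j : gmap Y Z) : Prop :=
  bijective (fun s : X + Y => match s with inl x => i x | inr y => j y end).

(* The exponential diagram of f : A -> X and p : X -> Y.  Here q : P -> Y is the
   dependent product of f along p: its fibre over y is the set of sections of f
   over the fibre of p at y.  E is X x_Y P, p' is its projection to P, and ev is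
   the evaluation map, so that the projection to X is f o ev. *)
Record is_exponential (gT : finGroupType) (A X Y P E : gset gT)
    (f : gmap A X) (p : gmap X Y)
    (q : gmap P Y) (p' : gmap E P) (ev : gmap E A) : Prop := {
  exponential_pullback : is_pullback (gcomp f ev) p' p q;
  exponential_section : forall (y : Y) (s : {x : X | p x == y} -> A),
    (forall u, f (s u) = val u) ->
    exists! z : P, q z = y /\
      (forall e (u : {x : X | p x == y}),
        p' e = z -> f (ev e) = val u -> ev e = s u) }.

Record mackey_axioms (gT : finGroupType) (M : gset gT -> zmodType)
    (res : forall X Y : gset gT, gmap X Y -> M Y -> M X)
    (tr : forall X Y : gset gT, gmap X Y -> M X -> M Y) : Prop := {
  mresD : forall X Y (f : gmap X Y), {morph res X Y f : a b / a + b};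
  mtrD : forall X Y (f : gmap X Y), {morph tr X Y f : a b / a + b};
  mres_id : forall X (a : M X), res X X (gid X) a = a;
  mtr_id : forall X (a : M X), tr X X (gid X) a = a;
  mres_comp : forall X Y Z (g : gmap Y Z) (f : gmap X Y) a,
    res X Z (gcomp g f) a = res X Y f (res Y Z g a);
  mtr_comp : forall X Y Z (g : gmap Y Z) (f : gmap X Y) a,
    tr X Z (gcomp g f) a = tr Y Z g (tr X Y f a);
  mempty : forall X : gset gT, #|X| = 0%N -> forall a : M X, a = 0;
  mcoprod : forall X Y Z (i : gmap X Z) (j : gmap Y Z), is_coprod i j ->
    forall a b, exists! c, res X Z i c = a /\ res Y Z j c = b;
  mpullback : forall W X Y Z (p : gmap W X) (q : gmap W Y)
      (f : gmap X Z) (g : gmap Y Z), is_pullback p q f g ->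
    forall a, res Y Z g (tr X Z f a) = tr W Y q (res W X p a) }.

(* Forgetting [tnm] leaves a commutative Green functor: a Mackey functor with
   levelwise ring structures, multiplicative restrictions and Frobenius
   reciprocity. *)
Record tambara (gT : finGroupType) := Tambara {
  tval :> gset gT -> comPzRingType;
  tres : forall X Y : gset gT, gmap X Y -> tval Y -> tval X;
  ttr : forall X Y : gset gT, gmap X Y -> tval X -> tval Y;
  tnm : forall X Y : gset gT, gmap X Y -> tval X -> tval Y;
  tmackey : mackey_axioms (M := fun X => tval X) tres ttr;
  tres1 : forall X Y (f : gmap X Y), tres f 1 = 1;
  tresM : forall X Y (f : gmap X Y), {morph tres f : a b / a * b};
  tfrobenius : forall X Y (f : gmap X Y) a b,
    ttr f (a * tres f b) = ttr f a * b;
  tnm1 : forall X Y (f : gmap X Y), tnm f 1 = 1;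
  tnmM : forall X Y (f : gmap X Y), {morph tnm f : a b / a * b};
  tnm_id : forall X (a : tval X), tnm (gid X) a = a;
  tnm_comp : forall X Y Z (g : gmap Y Z) (f : gmap X Y) a,
    tnm (gcomp g f) a = tnm g (tnm f a);
  tnm_pullback : forall W X Y Z (p : gmap W X) (q : gmap W Y)
      (f : gmap X Z) (g : gmap Y Z), is_pullback p q f g ->
    forall a, tres g (tnm f a) = tnm q (tres p a);
  tnm_exponential : forall A X Y P E (f : gmap A X) (p : gmap X Y)
      (q : gmap P Y) (p' : gmap E P) (ev : gmap E A),
    is_exponential f p q p' ev ->
    forall a, tnm p (ttr f a) = ttr q (tnm p' (tres ev a)) }.

Record tam_hom (gT : finGroupType) (T U : tambara gT) := TamHom {
  tam_fun :> forall X, T X -> U X;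
  tam_homD : forall X, {morph tam_fun (X := X) : a b / a + b};
  tam_homM : forall X, {morph tam_fun (X := X) : a b / a * b};
  tam_hom1 : forall X, tam_fun (1 : T X) = 1;
  tam_hom_res : forall X Y (f : gmap X Y) a,
    tam_fun (tres f a) = tres f (tam_fun a);
  tam_hom_tr : forall X Y (f : gmap X Y) a,
    tam_fun (ttr f a) = ttr f (tam_fun a);
  tam_hom_nm : forall X Y (f : gmap X Y) a,
    tam_fun (tnm f a) = tnm f (tam_fun a) }.

Record kalg (gT : finGroupType) (k : tambara gT) := KAlg {
  kalg_tam :> tambara gT;
  kalg_unit : tam_hom k kalg_tam }.

Record kalg_hom (gT : finGroupType) (k : tambara gT) (R S : kalg k) := KAlgHom {
  kalg_fun :> tam_hom R S;
  kalg_homP : forall X (a : k X),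
    kalg_fun X (kalg_unit R X a) = kalg_unit S X a }.

Record kmod (gT : finGroupType) (k : tambara gT) := KMod {
  mval :> forall X : gset gT, lmodType (k X);
  mres : forall X Y : gset gT, gmap X Y -> mval Y -> mval X;
  mtr : forall X Y : gset gT, gmap X Y -> mval X -> mval Y;
  mmackey : mackey_axioms (M := fun X => mval X) mres mtr;
  mresZ : forall X Y (f : gmap X Y) (a : k Y) m,
    mres f (a *: m) = tres f a *: mres f m;
  mfrobeniusl : forall X Y (f : gmap X Y) (a : k X) m,
    mtr f (a *: mres f m) = ttr f a *: m;
  mfrobeniusr : forall X Y (f : gmap X Y) (a : k Y) m,
    mtr f (tres f a *: m) = a *: mtr f m }.

Record kmod_hom (gT : finGroupType) (k : tambara gT) (M N : kmod k) := KModHom {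
  kmod_fun :> forall X, M X -> N X;
  kmod_homD : forall X, {morph kmod_fun (X := X) : a b / a + b};
  kmod_homZ : forall X (a : k X) m, kmod_fun (a *: m) = a *: kmod_fun m;
  kmod_hom_res : forall X Y (f : gmap X Y) m,
    kmod_fun (mres f m) = mres f (kmod_fun m);
  kmod_hom_tr : forall X Y (f : gmap X Y) m,
    kmod_fun (mtr f m) = mtr f (kmod_fun m) }.

Definition restr_car (gT : finGroupType) (k : tambara gT) (R : kalg k)
  (X : gset gT) : Type := R X.

Section RestrictScalars.
Variables (gT : finGroupType) (k : tambara gT) (R : kalg k).

HB.instance Definition _ X := GRing.Zmodule.on (restr_car R X).

Definition restr_scale X (a : k X) (m : restr_car R X) : restr_car R X :=
  kalg_unit R X a * m.

Fact restr_scaleA X a b (m : restr_car R X) :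
  restr_scale a (restr_scale b m) = restr_scale (a * b) m.
Proof. by rewrite /restr_scale tam_homM mulrA. Qed.

Fact restr_scale1 X : left_id (1 : k X) (@restr_scale X).
Proof. by move=> m; rewrite /restr_scale tam_hom1 mul1r. Qed.

Fact restr_scaleDr X : right_distributive (@restr_scale X) +%R.
Proof. by move=> a m n; rewrite /restr_scale mulrDr. Qed.

Fact restr_scaleDl X (m : restr_car R X) :
  {morph (@restr_scale X)^~ m : a b / a + b}.
Proof. by move=> a b; rewrite /restr_scale tam_homD mulrDl. Qed.

HB.instance Definition _ X := GRing.Zmodule_isLmodule.Build (k X)
  (restr_car R X) (@restr_scaleA X) (@restr_scale1 X)
  (@restr_scaleDr X) (@restr_scaleDl X).

Fact restr_mackey :
  mackey_axioms (M := fun X => restr_car R X) (@tres gT R) (@ttr gT R).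
Proof. exact: tmackey. Qed.

Fact restr_resZ X Y (f : gmap X Y) (a : k Y) (m : restr_car R Y) :
  tres f (a *: m : restr_car R Y) = (tres f a *: (tres f m : restr_car R X)).
Proof. by rewrite /GRing.scale /= /restr_scale tresM tam_hom_res. Qed.

Fact restr_frobeniusl X Y (f : gmap X Y) (a : k X) (m : restr_car R Y) :
  ttr f (a *: (tres f m : restr_car R X) : restr_car R X) = ttr f a *: m.
Proof. by rewrite /GRing.scale /= /restr_scale tfrobenius tam_hom_tr. Qed.

Fact restr_frobeniusr X Y (f : gmap X Y) (a : k Y) (m : restr_car R X) :
  ttr f (tres f a *: m : restr_car R X) = a *: (ttr f m : restr_car R Y).
Proof.
by rewrite /GRing.scale /= /restr_scale tam_hom_res mulrC tfrobenius mulrC.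
Qed.

Definition kalg_mod : kmod k :=
  @KMod gT k (fun X => restr_car R X) (@tres gT R) (@ttr gT R)
    restr_mackey restr_resZ restr_frobeniusl restr_frobeniusr.

End RestrictScalars.

(* k-bilinear Dress pairings; the relative box product of M and N over k is the
   k-module representing them. *)
Record is_pairing (gT : finGroupType) (k : tambara gT) (M N P : kmod k)
    (b : forall X, M X -> N X -> P X) : Prop := {
  pairingDl : forall X m m' n, b X (m + m') n = b X m n + b X m' n;
  pairingDr : forall X m n n', b X m (n + n') = b X m n + b X m n';
  pairingZl : forall X (a : k X) m n, b X (a *: m) n = a *: b X m n;
  pairingZr : forall X (a : k X) m n, b X m (a *: n) = a *: b X m n;
  pairing_res : forall X Y (f : gmap X Y) m n,
    b X (mres f m) (mres f n) = mres f (b Y m n);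
  pairing_frobeniusl : forall X Y (f : gmap X Y) m n,
    mtr f (b X m (mres f n)) = b Y (mtr f m) n;
  pairing_frobeniusr : forall X Y (f : gmap X Y) m n,
    mtr f (b X (mres f m) n) = b Y m (mtr f n) }.

Record is_box (gT : finGroupType) (k : tambara gT) (M N P : kmod k)
    (b : forall X, M X -> N X -> P X) : Prop := {
  box_pairing : is_pairing b;
  box_univ : forall (Q : kmod k) (c : forall X, M X -> N X -> Q X),
    is_pairing c ->
    exists h : kmod_hom P Q, (forall X m n, h X (b X m n) = c X m n) /\
      (forall h' : kmod_hom P Q, (forall X m n, h' X (b X m n) = c X m n) ->
        forall X x, h' X x = h X x) }.

Record short_exact (gT : finGroupType) (k : tambara gT) (M N P : kmod k)
    (f : kmod_hom M N) (g : kmod_hom N P) : Prop := {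
  short_exact_inj : forall X (m : M X), f X m = 0 -> m = 0;
  short_exact_mid : forall X (n : N X), g X n = 0 <-> exists m, f X m = n;
  short_exact_surj : forall X (p : P X), exists n, g X n = p }.

(* B N is the box product of M and N over k.  It is unique up to a unique
   isomorphism, so flatness does not depend on the choice of B and b. *)
Definition flat (gT : finGroupType) (k : tambara gT) (M : kmod k) : Prop :=
  exists (B : kmod k -> kmod k) (b : forall (N : kmod k) X, M X -> N X -> B N X),
    (forall N, is_box (b N)) /\
    (forall (N1 N2 N3 : kmod k) (f : kmod_hom N1 N2) (g : kmod_hom N2 N3)
        (Bf : kmod_hom (B N1) (B N2)) (Bg : kmod_hom (B N2) (B N3)),
      (forall X m n, Bf X (b N1 X m n) = b N2 X m (f X n)) ->
      (forall X m n, Bg X (b N2 X m n) = b N3 X m (g X n)) ->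
      short_exact f g -> short_exact Bf Bg).

(* P is the relative box product of the k-algebras R and S: its underlying
   k-module is the box product of the underlying k-modules, and its Tambara
   structure is the one for which r |-> r # 1 and s |-> 1 # s are morphisms. *)
Definition is_box_alg (gT : finGroupType) (k : tambara gT) (R S P : kalg k)
    (i : kalg_hom R P) (j : kalg_hom S P) : Prop :=
  @is_box gT k (kalg_mod R) (kalg_mod S) (kalg_mod P)
    (fun X (r : R X) (s : S X) => (i X r * j X s : P X)).

Definition tker (gT : finGroupType) (T U : tambara gT) (h : tam_hom T U)
  (X : gset gT) (a : T X) : Prop := h X a = 0.

Definition is_ideal (gT : finGroupType) (T : tambara gT)
    (I : forall X, T X -> Prop) : Prop :=
  exists (U : tambara gT) (h : tam_hom T U), forall X a, I X a <-> tker h a.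

Definition ideal_gen (gT : finGroupType) (T : tambara gT)
    (S : forall X, T X -> Prop) (X : gset gT) (a : T X) : Prop :=
  forall I : (forall Y, T Y -> Prop),
    is_ideal I -> (forall Y b, S Y b -> I Y b) -> I X a.

Inductive family_mem (gT : finGroupType) (T : tambara gT) (n : nat)
    (X : 'I_n -> gset gT) (x : forall i, T (X i)) : forall Y, T Y -> Prop :=
  FamilyMem i : family_mem x (x i).

Definition fin_gen_ideal (gT : finGroupType) (T : tambara gT)
    (I : forall X, T X -> Prop) : Prop :=
  exists (n : nat) (X : 'I_n -> gset gT) (x : forall i, T (X i)),
    forall Y a, I Y a <-> ideal_gen (family_mem x) a.

(* A map of orbits G/K' -> G/H exists iff K' is conjugate to a subgroup of H,
   and it is not injective iff that subgroup is proper. *)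
Inductive ideal_gt1_gens (gT : finGroupType) (T : tambara gT)
    (I : forall X, T X -> Prop) : forall X, T X -> Prop :=
  | Gt1Mul X (a b : T X) : is_orbit X -> I X a -> I X b ->
      ideal_gt1_gens I (a * b)
  | Gt1Nm Y X (f : gmap Y X) (a : T Y) : is_orbit Y -> is_orbit X ->
      ~ injective f -> I Y a -> ideal_gt1_gens I (tnm f a).

Definition ideal_gt1 (gT : finGroupType) (T : tambara gT)
    (I : forall X, T X -> Prop) : forall X, T X -> Prop :=
  ideal_gen (ideal_gt1_gens I).

Definition tcoset (gT : finGroupType) (T : tambara gT)
    (J : forall X, T X -> Prop) (X : gset gT) (a : T X) : T X -> Prop :=
  fun b => J X (b - a).

(* The elements of (I/J)(X), as cosets of J(X). *)
Definition tquot (gT : finGroupType) (T : tambara gT)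
    (I J : forall X, T X -> Prop) (X : gset gT) (A : T X -> Prop) : Prop :=
  exists2 a, I X a & A = tcoset J a.

(* Elements of the genuine Kaehler differentials, mu being the multiplication
   map of the relative box square of R. *)
Definition kahler (gT : finGroupType) (T R : tambara gT) (mu : tam_hom T R)
  (X : gset gT) : (T X -> Prop) -> Prop :=
  tquot (@tker gT T R mu) (ideal_gt1 (@tker gT T R mu)) (X := X).

(* Again P, i, j are unique up to a unique isomorphism, and mu is determined by
   them. *)
Definition kahler_zero (gT : finGroupType) (k : tambara gT) (R : kalg k) :
    Prop :=
  exists (P : kalg k) (i j : kalg_hom R P) (mu : kalg_hom P R),
    [/\ is_box_alg i j,
        forall X (r : R X), mu X (i X r) = r,
        forall X (r : R X), mu X (j X r) = r
      & forall X (w : P X -> Prop), kahler mu w ->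
          w = tcoset (ideal_gt1 (@tker gT P R mu)) 0].

Definition formally_etale (gT : finGroupType) (k : tambara gT) (R : kalg k) :
    Prop :=
  flat (kalg_mod R) /\ kahler_zero R.

(* P is the free polynomial k-algebra on generators x i in level X i: it
   represents R |-> prod_i R(X i). *)
Definition is_free_poly (gT : finGroupType) (k : tambara gT) (n : nat)
    (X : 'I_n -> gset gT) (P : kalg k) (x : forall i, P (X i)) : Prop :=
  forall (R : kalg k) (r : forall i, R (X i)),
    exists h : kalg_hom P R, (forall i, h (X i) (x i) = r i) /\
      (forall h' : kalg_hom P R, (forall i, h' (X i) (x i) = r i) ->
        forall Y a, h' Y a = h Y a).

Definition is_coequalizer (gT : finGroupType) (k : tambara gT)
    (Q P R : kalg k) (u v : kalg_hom Q P) (q : kalg_hom P R) : Prop :=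
  (forall X a, q X (u X a) = q X (v X a)) /\
  (forall (T : kalg k) (h : kalg_hom P T),
    (forall X a, h X (u X a) = h X (v X a)) ->
    exists g : kalg_hom R T, (forall X a, g X (q X a) = h X a) /\
      (forall g' : kalg_hom R T, (forall X a, g' X (q X a) = h X a) ->
        forall X a, g' X a = g X a)).

Definition finitely_presented (gT : finGroupType) (k : tambara gT)
    (R : kalg k) : Prop :=
  exists (m : nat) (Y : 'I_m -> gset gT) (Q : kalg k) (y : forall i, Q (Y i))
      (n : nat) (X : 'I_n -> gset gT) (P : kalg k) (x : forall i, P (X i))
      (u v : kalg_hom Q P) (q : kalg_hom P R),
    [/\ is_free_poly y, is_free_poly x & is_coequalizer u v q].

Definition etale (gT : finGroupType) (k : tambara gT) (R : kalg k) : Prop :=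
  formally_etale R /\ finitely_presented R.

Definition hilbert_basis (gT : finGroupType) (k : tambara gT) : Prop :=
  forall (n : nat) (X : 'I_n -> gset gT) (P : kalg k) (x : forall i, P (X i)),
    is_free_poly x ->
    forall I : (forall Y, P Y -> Prop), is_ideal I -> fin_gen_ideal I.

Record ring_action (gT : finGroupType) (S : comPzRingType) := RingAction {
  ract :> gT -> {rmorphism S -> S};
  ract1 : forall s, ract 1%g s = s;
  ractM : forall a b s, ract (a * b)%g s = ract b (ract a s) }.

(* FP(S)(X) is the ring of equivariant maps X -> S.  For X = G/H, evaluation at
   the trivial coset identifies it with the fixed ring S^H. *)
Definition fp_pred (gT : finGroupType) (S : comPzRingType)
    (s : ring_action gT S) (X : gset gT) : {pred {ffun X -> S}} :=
  fun f => [forall x, forall a, f (gact X x a) == s a (f x)].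
Arguments fp_pred {gT S} s X.

Record fp (gT : finGroupType) (S : comPzRingType) (s : ring_action gT S)
    (X : gset gT) := Fp {
  fp_fun :> {ffun X -> S};
  fp_funP : fp_fun \in fp_pred s X }.

Section FixedPoint.
Variables (gT : finGroupType) (S : comPzRingType) (s : ring_action gT S).
Implicit Types X Y Z : gset gT.

HB.instance Definition _ X := [isSub for @fp_fun gT S s X].
HB.instance Definition _ X := [Choice of fp s X by <:].

Lemma fp_predP X (f : {ffun X -> S}) :
  reflect (forall x a, f (gact X x a) = s a (f x)) (f \in fp_pred s X).
Proof. by apply: (iffP 'forall_'forall_eqP) => h x a; rewrite h. Qed.

Lemma fpJ X (f : fp s X) x a : f (gact X x a) = s a (f x).
Proof. exact/fp_predP/fp_funP. Qed.

Lemma fp_ext X (f g : fp s X) : f =1 g -> f = g.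
Proof. by move=> fg; apply/val_inj/ffunP. Qed.

Fact fp_subring X : subring_closed (fp_pred s X).
Proof.
split=> [|f g /fp_predP fP /fp_predP gP|f g /fp_predP fP /fp_predP gP].
- by apply/fp_predP => x a; rewrite !ffunE rmorph1.
- by apply/fp_predP => x a; rewrite !ffunE fP gP rmorphB.
- by apply/fp_predP => x a; rewrite !ffunE fP gP rmorphM.
Qed.

HB.instance Definition _ X :=
  GRing.SubChoice_isSubPzRing.Build _ _ (fp s X) (@fp_subring X).

Fact fp_mulC X : commutative (@GRing.mul (fp s X)).
Proof. by move=> f g; apply: fp_ext => x; rewrite !ffunE mulrC. Qed.

HB.instance Definition _ X :=
  GRing.PzRing_hasCommutativeMul.Build (fp s X) (@fp_mulC X).

Fact fp_res_subproof X Y (f : gmap X Y) (a : fp s Y) :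
  [ffun x => a (f x)] \in fp_pred s X.
Proof. by apply/fp_predP => x g; rewrite !ffunE gmapJ fpJ. Qed.

Definition fp_res X Y (f : gmap X Y) (a : fp s Y) : fp s X :=
  Fp (fp_res_subproof f a).

Lemma fibreJ X Y (f : gmap X Y) x y g :
  (f (gact X x g) == gact Y y g) = (f x == y).
Proof. by rewrite gmapJ (inj_eq (act_inj _ _)). Qed.

Fact fp_tr_subproof X Y (f : gmap X Y) (a : fp s X) :
  [ffun y => \sum_(x | f x == y) a x] \in fp_pred s Y.
Proof.
apply/fp_predP => y g; rewrite !ffunE rmorph_sum.
rewrite (reindex_inj (act_inj (gact X) g)).
by apply: eq_big => [x|x _]; rewrite ?fibreJ ?fpJ.
Qed.

Definition fp_tr X Y (f : gmap X Y) (a : fp s X) : fp s Y :=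
  Fp (fp_tr_subproof f a).

Fact fp_nm_subproof X Y (f : gmap X Y) (a : fp s X) :
  [ffun y => \prod_(x | f x == y) a x] \in fp_pred s Y.
Proof.
apply/fp_predP => y g; rewrite !ffunE rmorph_prod.
rewrite (reindex_inj (act_inj (gact X) g)).
by apply: eq_big => [x|x _]; rewrite ?fibreJ ?fpJ.
Qed.

Definition fp_nm X Y (f : gmap X Y) (a : fp s X) : fp s Y :=
  Fp (fp_nm_subproof f a).

Lemma pullback_big (R : Type) (idx : R) (op : Monoid.com_law idx)
    W X Y Z (p : gmap W X) (q : gmap W Y) (f : gmap X Z) (g : gmap Y Z)
    (F : X -> R) y : is_pullback p q f g ->
  \big[op/idx]_(x | f x == g y) F x = \big[op/idx]_(w | q w == y) F (p w).
Proof.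
move=> [comm univ].
have imP : forall x, (f x == g y) = (x \in [set p w | w in [pred w | q w == y]]).
  move=> x; apply/eqP/imsetP => [/univ[w [[<- <-] _]]|[w]].
    by exists w; rewrite ?inE.
  by rewrite inE => /eqP <- ->.
rewrite (eq_bigl _ _ imP) big_imset //= => w w'; rewrite !inE => /eqP qw /eqP qw' pw.
have /univ[v [_ uv]] : f (p w) = g y by rewrite comm qw.
by rewrite -(uv w) // (uv w').
Qed.

Lemma exponential_big A X Y P E (f : gmap A X) (p : gmap X Y)
    (q : gmap P Y) (p' : gmap E P) (ev : gmap E A) (F : A -> S) y :
  is_exponential f p q p' ev ->
  \prod_(x | p x == y) \sum_(a | f a == x) F a =
  \sum_(z | q z == y) \prod_(e | p' e == z) F (ev e).
Proof.
move=> [pb sec]; have [comm univ] := pb.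
have evK e e' : p' e = p' e' -> f (ev e) = f (ev e') -> e = e'.
  move=> p'e fe; have [v [_ uv]] := univ _ _ (comm e).
  by rewrite -(uv e) // (uv e').
pose F' o := if o is Some a then F a else 1.
pose Q x o := if p x == y then (if o is Some a then f a == x else false)
              else o == None.
pose h z := [ffun x => if p x == y then
  omap ev [pick e | (p' e == z) && (f (ev e) == x)] else None].
have hE z e : q z = y -> p' e = z -> h z (f (ev e)) = Some (ev e).
  move=> qz pe; rewrite ffunE [p _]comm pe qz eqxx.
  case: pickP => [e' /andP[/eqP pe' /eqP fe']|/(_ e)]; last by rewrite pe !eqxx.
  by rewrite (evK e' e) ?pe.
transitivity (\prod_x \sum_(o | Q x o) F' o).
  rewrite big_mkcond; apply: eq_bigr => x _; rewrite /Q.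
  case: ifP => _; last by rewrite big_pred1_eq.
  rewrite (reindex_omap Some id) /=; first by apply: eq_bigl => a; rewrite eqxx andbT.
  by case.
rewrite bigA_distr_big_dep.
have imP o : (o \in family Q) = (o \in [set h z | z in [pred z | q z == y]]).
  apply/familyP/imsetP => [oQ|[z]].
    have oS (u : {x : X | p x == y}) : {a | o (val u) = Some a & f a = val u}.
      have := oQ (val u); rewrite unfold_in /Q (valP u).
      by case: (o _) => // a /eqP; exists a.
    have [u|z [[qz zs] _]] := sec y (fun u => s2val (oS u)).
      by case: (oS u).
    exists z; first by rewrite inE qz.
    apply/ffunP => x; have [px|npx] := eqVneq (p x) y; last first.
      have := oQ x; rewrite unfold_in /Q ffunE (negPf npx); exact/eqP.
    have [e [[fe pe] _]] := univ x z (etrans px (esym qz)).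
    rewrite -{2}fe hE //; have pxb : p x == y by apply/eqP.
    rewrite (zs e (Sub x pxb)) //=.
    by case: (oS _).
  rewrite inE => /eqP qz -> x; rewrite unfold_in /Q ffunE.
  case: eqP => // px; case: pickP => [e /andP[] //|] /= h0.
  have [e [[fe pe] _]] := univ x z (etrans px (esym qz)).
  by have := h0 e; rewrite -[f (ev e)]/(gcomp f ev e) fe pe !eqxx.
rewrite (eq_bigl _ _ imP) big_imset /=; last first.
  move=> z z'; rewrite !inE => /eqP qz /eqP qz' hz.
  have sP (u : {x : X | p x == y}) :
      {a | h z (val u) = Some a & f a = val u}.
    have px := eqP (valP u); rewrite ffunE px eqxx.
    case: pickP => [e /andP[_ /eqP fe]|h0]; first by exists (ev e).
    exfalso; have [e [[fe pe] _]] := univ _ z (etrans px (esym qz)).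
    by have := h0 e; rewrite -[f (ev e)]/(gcomp f ev e) fe pe !eqxx.
  have [u|v [_ uv]] := sec y (fun u => s2val (sP u)); first by case: (sP u).
  have zv w : q w = y -> h w = h z -> v = w.
    move=> qw hw; apply: uv; split=> // e u pe fe.
    case: (sP u) => a /= + _; rewrite -fe -hw hE //; by case.
  by rewrite -(zv z) // (zv z').
apply: eq_big => [z|z]; rewrite !inE // => /eqP qz.
transitivity (\prod_(x | p x == q z) F' (h z x)).
  rewrite qz [RHS]big_mkcond; apply: eq_bigr => x _.
  by case: ifP => // px; rewrite ffunE px.
rewrite (pullback_big _ _ _ pb); apply: eq_bigr => e /eqP pe.
by rewrite [h z _]hE.
Qed.

Fact fp_mackey : mackey_axioms (M := fun X => fp s X) fp_res fp_tr.
Proof.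
split.
- by move=> X Y f a b; apply: fp_ext => x; rewrite !ffunE.
- by move=> X Y f a b; apply: fp_ext => y; rewrite !ffunE -big_split;
    apply: eq_bigr => x _; rewrite ffunE.
- by move=> X a; apply: fp_ext => x; rewrite ffunE.
- by move=> X a; apply: fp_ext => x; rewrite ffunE big_pred1_eq.
- by move=> X Y Z g f a; apply: fp_ext => x; rewrite !ffunE.
- move=> X Y Z g f a; apply: fp_ext => z; rewrite !ffunE.
  rewrite (partition_big f (fun y => g y == z)) //=.
  apply: eq_bigr => y gy; rewrite ffunE; apply: eq_bigl => x.
  by apply: andb_idl => /eqP ->.
- move=> X X0 a; apply: fp_ext => x.
  by have := card0_eq X0 x; rewrite inE.
- move=> X Y Z i j [t tK Kt] a b.
  pose c := [ffun z => match t z with inl x => a x | inr y => b y end].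
  have tJ z g : t (gact Z z g) = match t z with
      inl x => inl (gact X x g) | inr y => inr (gact Y y g) end.
    apply: (can_inj tK); rewrite Kt -{1}(Kt z).
    by case: (t z) => u; rewrite gmapJ.
  have cP : c \in fp_pred s Z.
    by apply/fp_predP => z g; rewrite !ffunE tJ; case: (t z) => u; rewrite fpJ.
  exists (Fp cP); split=> [|c' [ca cb]].
    by split; apply: fp_ext => u; rewrite !ffunE ?(tK (inl u)) ?(tK (inr u)).
  apply: fp_ext => z; rewrite ffunE -[in RHS](Kt z).
  by case: (t z) => u; rewrite -?ca -?cb ffunE.
- move=> W X Y Z p q f g pb a; apply: fp_ext => y; rewrite !ffunE.
  by rewrite (pullback_big _ _ _ pb); apply: eq_bigr => w _; rewrite ffunE.
Qed.

Fact fp_res1 X Y (f : gmap X Y) : fp_res f 1 = 1.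
Proof. by apply: fp_ext => x; rewrite !ffunE. Qed.

Fact fp_resM X Y (f : gmap X Y) : {morph fp_res f : a b / a * b}.
Proof. by move=> a b; apply: fp_ext => x; rewrite !ffunE. Qed.

Fact fp_frobenius X Y (f : gmap X Y) a b :
  fp_tr f (a * fp_res f b) = fp_tr f a * b.
Proof.
apply: fp_ext => y; rewrite !ffunE mulr_suml.
by apply: eq_bigr => x /eqP <-; rewrite !ffunE.
Qed.

Fact fp_nm1 X Y (f : gmap X Y) : fp_nm f 1 = 1.
Proof.
by apply: fp_ext => y; rewrite !ffunE big1 // => x _; rewrite ffunE.
Qed.

Fact fp_nmM X Y (f : gmap X Y) : {morph fp_nm f : a b / a * b}.
Proof.
move=> a b; apply: fp_ext => y; rewrite !ffunE -big_split.
by apply: eq_bigr => x _; rewrite ffunE.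
Qed.

Fact fp_nm_id X (a : fp s X) : fp_nm (gid X) a = a.
Proof. by apply: fp_ext => x; rewrite ffunE big_pred1_eq. Qed.

Fact fp_nm_comp X Y Z (g : gmap Y Z) (f : gmap X Y) a :
  fp_nm (gcomp g f) a = fp_nm g (fp_nm f a).
Proof.
apply: fp_ext => z; rewrite !ffunE.
rewrite (partition_big f (fun y => g y == z)) //=.
apply: eq_bigr => y gy; rewrite ffunE; apply: eq_bigl => x.
by apply: andb_idl => /eqP ->.
Qed.

Fact fp_nm_pullback W X Y Z (p : gmap W X) (q : gmap W Y) (f : gmap X Z)
    (g : gmap Y Z) : is_pullback p q f g ->
  forall a, fp_res g (fp_nm f a) = fp_nm q (fp_res p a).
Proof.
move=> pb a; apply: fp_ext => y; rewrite !ffunE.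
by rewrite (pullback_big _ _ _ pb); apply: eq_bigr => w _; rewrite ffunE.
Qed.

Fact fp_exponential A X Y P E (f : gmap A X) (p : gmap X Y)
    (q : gmap P Y) (p' : gmap E P) (ev : gmap E A) :
  is_exponential f p q p' ev ->
  forall a, fp_nm p (fp_tr f a) = fp_tr q (fp_nm p' (fp_res ev a)).
Proof.
move=> ex a; apply: fp_ext => y; rewrite !ffunE.
under eq_bigr do rewrite ffunE; rewrite (exponential_big _ _ ex).
apply: eq_bigr => z _; rewrite ffunE.
by apply: eq_bigr => e _; rewrite ffunE.
Qed.

Definition FP : tambara gT :=
  @Tambara gT (fun X => fp s X) fp_res fp_tr fp_nm fp_mackey fp_res1 fp_resM
    fp_frobenius fp_nm1 fp_nmM fp_nm_id fp_nm_comp fp_nm_pullback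
    fp_exponential.

End FixedPoint.

Section FixedPointMap.
Variables (gT : finGroupType) (S T : comPzRingType).
Variables (s : ring_action gT S) (t : ring_action gT T).
Variables (h : {rmorphism S -> T}) (hJ : forall a x, h (s a x) = t a (h x)).

Fact fp_map_subproof X (f : fp s X) : [ffun x => h (f x)] \in fp_pred t X.
Proof. by apply/fp_predP => x a; rewrite !ffunE fpJ hJ. Qed.

Definition fp_map X (f : FP s X) : FP t X := Fp (fp_map_subproof f).

Fact fp_mapD X : {morph @fp_map X : a b / a + b}.
Proof. by move=> a b; apply: fp_ext => x; rewrite !ffunE rmorphD. Qed.

Fact fp_mapM X : {morph @fp_map X : a b / a * b}.
Proof. by move=> a b; apply: fp_ext => x; rewrite !ffunE rmorphM. Qed.

Fact fp_map1 X : fp_map (1 : FP s X) = 1.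
Proof. by apply: fp_ext => x; rewrite !ffunE rmorph1. Qed.

Fact fp_map_res X Y (f : gmap X Y) a : fp_map (tres f a) = tres f (fp_map a).
Proof. by apply: fp_ext => x; rewrite !ffunE. Qed.

Fact fp_map_tr X Y (f : gmap X Y) a : fp_map (ttr f a) = ttr f (fp_map a).
Proof.
apply: fp_ext => x; rewrite !ffunE rmorph_sum.
by apply: eq_bigr => y _; rewrite ffunE.
Qed.

Fact fp_map_nm X Y (f : gmap X Y) a : fp_map (tnm f a) = tnm f (fp_map a).
Proof.
apply: fp_ext => x; rewrite !ffunE rmorph_prod.
by apply: eq_bigr => y _; rewrite ffunE.
Qed.

Definition FP_map : tam_hom (FP s) (FP t) :=
  TamHom fp_mapD fp_mapM fp_map1 fp_map_res fp_map_tr fp_map_nm.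

End FixedPointMap.

Definition trivial_action (gT : finGroupType) (S : comPzRingType) :
    ring_action gT S :=
  @RingAction gT S (fun _ => idfun) (fun s => erefl s) (fun _ _ s => erefl s).

Definition constT (gT : finGroupType) (S : comPzRingType) : tambara gT :=
  FP (trivial_action gT S).

Section GaloisAction.
Variables (gT : finGroupType) (K : fieldType) (L : splittingFieldType K).
Variable phi : {morphism [set: gT] >-> gal_of {:L}}.

Definition gal_action_fun (a : gT) : {rmorphism L -> L} :=
  GRing.RMorphism.clone L L (gal_repr (phi a)) _.

Fact gal_action1 x : gal_action_fun 1%g x = x.
Proof. by rewrite /= morph1; apply: gal_id. Qed.

Fact gal_actionM a b x :
  gal_action_fun (a * b)%g x = gal_action_fun b (gal_action_fun a x).
Proof. by rewrite /= morphM ?inE //; apply: galM; apply: memvf. Qed.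

Definition gal_action : ring_action gT L :=
  RingAction gal_action1 gal_actionM.

Fact in_alg_equivariant (a : gT) (x : K) :
  in_alg L (trivial_action gT K a x) = gal_action a (in_alg L x).
Proof. by rewrite /= linearZ /= rmorph1. Qed.

(* FP(L) as an algebra over the constant Tambara functor at K. *)
Definition FP_ext : kalg (constT gT K) :=
  KAlg (FP_map in_alg_equivariant).

End GaloisAction.

(* Main.v *)
(* Let w_i, d_i in L be dual bases in the sense that sum_i g(w_i) d_i is 1 for
   g = 1 and 0 for the other g in G, and let e in L have trace 1.  The trace
   forms of the d_i, together with the elements e w_i in level G/e, exhibit
   FP(L) as a direct summand of finitely many copies of the module
   X |-> K(X x G).  The box product of the latter with N is N(- x G), which is
   exact in N, so FP(L) is flat.  The same dual basis identifies FP(L) [x] FP(L)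
   with FP(L (x)_K L), and L (x)_K L with the ring of functions G -> L.  The
   kernel of the multiplication is generated by the idempotent function that is
   0 at 1 and 1 elsewhere, whence I = I^2 and the differentials vanish.

   Every element of FP(L)(X) is a sum of transfers of K-linear combinations of
   the w_i in level G/e, so FP(L) is a quotient of a finitely generated free
   polynomial algebra; under the Hilbert basis property the kernel is finitely
   generated, and mapping free generators to its generators and to 0 gives a
   finite presentation. *)

Require Import Defs.
From HB Require Import structures.
From mathcomp Require Import all_boot all_order all_fingroup all_algebra.
From mathcomp Require Import falgebra fieldext galois.
From mathcomp Require Import boolp.
Import Defs.

Set Implicit Arguments.
Unset Strict Implicit.
Unset Printing Implicit Defensive.

Import GRing.Theory.
Local Open Scope ring_scope.

(** * Equivariant maps and codes for finite G-sets *)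

Lemma gmap_ext (gT : finGroupType) (X Y : gset gT) (f g : gmap X Y) :
  f =1 g -> f = g.
Proof.
case: f g => [f fP] [g gP] /= /funext fg; rewrite fg in fP *.
by congr GMap; apply: Prop_irrelevance.
Qed.

Section Codes.
Variable gT : finGroupType.

(* Small codes for finite G-sets: terms indexed by the G-sets themselves would
   live in a universe above that of the values of Mackey functors. *)
Record gcode := GCode {
  gcode_size : nat;
  gcode_act : 'I_gcode_size -> gT -> 'I_gcode_size;
  gcode_act1 : gcode_act^~ 1%g =1 id;
  gcode_actM : forall x, act_morph gcode_act x }.

Definition gdec (c : gcode) : gset gT :=
  GSet (TotalAction (@gcode_act1 c) (@gcode_actM c)).

Variable X : gset gT.

Definition genc_act (x : 'I_#|X|) a := enum_rank (gact X (enum_val x) a).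

Fact genc_act1 : genc_act^~ 1%g =1 id.
Proof. by move=> x; rewrite /genc_act act1 enum_valK. Qed.

Fact genc_actM x : act_morph genc_act x.
Proof. by move=> a b; rewrite /genc_act enum_rankK actMin ?inE. Qed.

Definition genc : gcode := GCode genc_act1 genc_actM.

Fact gto_subproof x a :
  enum_rank (gact X x a) = gact (gdec genc) (enum_rank x) a.
Proof. by rewrite /= /genc_act enum_rankK. Qed.

Definition gto : gmap X (gdec genc) :=
  @GMap gT X (gdec genc) (fun x => enum_rank x) gto_subproof.

Fact gfrom_subproof (x : gdec genc) a :
  enum_val (gact (gdec genc) x a) = gact X (enum_val x) a.
Proof. by rewrite /= /genc_act enum_rankK. Qed.

Definition gfrom : gmap (gdec genc) X :=
  @GMap gT (gdec genc) X (fun x => enum_val x) gfrom_subproof.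

Lemma gtoK : gcomp gfrom gto = gid X.
Proof. by apply: gmap_ext => x /=; rewrite enum_rankK. Qed.

Lemma gfromK : gcomp gto gfrom = gid (gdec genc).
Proof. by apply: gmap_ext => x /=; rewrite enum_valK. Qed.

End Codes.

Definition gencm (gT : finGroupType) (X Y : gset gT) (f : gmap X Y) :
    gmap (gdec (genc X)) (gdec (genc Y)) :=
  gcomp (gto Y) (gcomp f (gfrom X)).

Lemma gencm_comm (gT : finGroupType) (X Y : gset gT) (f : gmap X Y) :
  gcomp (gencm f) (gto X) = gcomp (gto Y) f.
Proof. by apply: gmap_ext => x /=; rewrite enum_rankK. Qed.

(** [gto X] and [gto Y] are bijections. Base change along this square carries transfers and norms
    along [f] over to the coded map [gencm f]. *)
Lemma gencm_pullback (gT : finGroupType) (X Y : gset gT) (f : gmap X Y) :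
  is_pullback (gto X) f (gencm f) (gto Y).
Proof.
split=> [x|x y /= /enum_rank_inj <-]; first by rewrite /= enum_rankK.
exists (enum_val x); split=> [|x' [<- _]]; last by rewrite /= enum_rankK.
by rewrite /= enum_valK.
Qed.

(** * Coproducts in Mackey functors and quotients of terms *)

Section AdditiveMaps.
Variables (U V : zmodType) (f : U -> V) (fD : {morph f : a b / a + b}).

Lemma morphD0 : f 0 = 0.
Proof. by apply: (addrI (f 0)); rewrite -fD !addr0. Qed.

Lemma morphDN a : f (- a) = - f a.
Proof. by apply: (addrI (f a)); rewrite -fD !subrr morphD0. Qed.

Lemma morphDB a b : f (a - b) = f a - f b.
Proof. by rewrite fD morphDN. Qed.

Lemma morphD_sum I (r : seq I) (P : pred I) F :
  f (\sum_(i <- r | P i) F i) = \sum_(i <- r | P i) f (F i).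
Proof. exact: (big_morph f fD morphD0). Qed.

End AdditiveMaps.

Section EmptyGset.
Variable gT : finGroupType.

Fact void_act1 : (fun (x : void) (_ : gT) => x)^~ 1%g =1 id.
Proof. by []. Qed.

Definition gvoid : gset gT :=
  @GSet gT void (TotalAction void_act1 (fun x _ _ => erefl x)).

Definition gfrom_void (X : gset gT) : gmap gvoid X :=
  @GMap gT gvoid X (of_void X) (fun x => match x with end).

End EmptyGset.

Lemma coprod_inj (gT : finGroupType) (X Y Z : gset gT)
    (i : gmap X Z) (j : gmap Y Z) :
  is_coprod i j ->
  [/\ injective i, injective j & forall x y, i x <> j y].
Proof.
move=> /bij_inj ij; split=> [x x' e|y y' e|x y e].
- by have [] := ij (inl x) (inl x') e.
- by have [] := ij (inr y) (inr y') e.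
- by have := ij (inl x) (inr y) e.
Qed.

Section MackeyCoproducts.
Variables (gT : finGroupType) (M : gset gT -> zmodType).
Variables (res : forall X Y : gset gT, gmap X Y -> M Y -> M X).
Variables (tr : forall X Y : gset gT, gmap X Y -> M X -> M Y).
Hypothesis ax : mackey_axioms res tr.

(** The pullback of an injective map along itself is its source, so base change gives the
    identity. *)
Lemma mackey_res_tr_inj X Z (i : gmap X Z) a :
  injective i -> res i (tr i a) = a.
Proof.
move=> ij; rewrite (mpullback ax (p := gid X) (q := gid X)).
  by rewrite (mres_id ax) (mtr_id ax).
split=> // x y /ij <-; exists x; split=> // x' []; auto.
Qed.

(** The pullback is the empty G-set, where every value is zero. *)
Lemma mackey_res_tr_disjoint X Y Z (i : gmap X Z) (j : gmap Y Z) a :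
  (forall x y, i x <> j y) -> res j (tr i a) = 0.
Proof.
move=> dij; rewrite (mpullback ax (p := gfrom_void X) (q := gfrom_void Y)).
  by rewrite (mempty ax _ (res _ a)) ?card_void// (morphD0 (mtrD ax _)).
by split=> [[]|x y /dij].
Qed.

(** An explicit solution in [mcoprod]: unlike bare existence, a formula in [res], [tr] and [+] can
    be checked after evaluation. *)
Lemma mackey_glue X Y Z (i : gmap X Z) (j : gmap Y Z) a b :
  is_coprod i j ->
  res i (tr i a + tr j b) = a /\ res j (tr i a + tr j b) = b.
Proof.
move=> /coprod_inj[ii jj ij]; rewrite !(mresD ax) !mackey_res_tr_inj //.
by rewrite !mackey_res_tr_disjoint ?addr0 ?add0r // => y x /esym/ij.
Qed.

(** Both sides have the same restrictions to the two summands, so uniqueness in [mcoprod]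
    applies. *)
Lemma mackey_unglue X Y Z (i : gmap X Z) (j : gmap Y Z) c :
  is_coprod i j -> tr i (res i c) + tr j (res j c) = c.
Proof.
move=> ij; have [c0 [_ u]] := mcoprod ax ij (res i c) (res j c).
by transitivity c0; [apply/esym/u; exact: mackey_glue | exact: u].
Qed.

Lemma mackey_gtoK X : cancel (res (gfrom X)) (res (gto X)).
Proof. by move=> a; rewrite -(mres_comp ax) gtoK (mres_id ax). Qed.

Lemma mackey_gto_inj X : injective (res (gto X)).
Proof.
move=> a b ab; rewrite -[a](mres_id ax) -[b](mres_id ax).
by rewrite -(gfromK X) !(mres_comp ax) ab.
Qed.

End MackeyCoproducts.

(* The quotient of the terms T by equality under all evaluations ev v.  The
   type of v only occurs inside a proposition, so this may range over large
   collections without raising the universe of the quotient. *)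
Section EvalQuotient.
Variables (T V : Type) (A : V -> Type) (ev : forall v, T -> A v).

Definition ev_class (t u : T) : Prop := forall v, ev v t = ev v u.

Definition equot : Type := {C : T -> Prop | exists t, C = ev_class t}.

Definition ecls (t : T) : equot := exist _ (ev_class t) (ex_intro _ t erefl).

Definition erep (x : equot) : T := sval (cid (svalP x)).

Definition qev v (x : equot) : A v := ev v (erep x).

Lemma qev_cls v t : qev v (ecls t) = ev v t.
Proof.
rewrite /qev /erep; case: cid => u /= e.
by have -> : ev_class t u by rewrite e.
Qed.

Lemma erepK x : ecls (erep x) = x.
Proof. by case: x => C p; apply: eq_exist; rewrite /erep; case: cid. Qed.

Lemma qev_inj x y : (forall v, qev v x = qev v y) -> x = y.
Proof.
move=> xy; rewrite -[x]erepK -[y]erepK; apply: eq_exist.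
rewrite /ev_class predeqE => u; rewrite /qev in xy.
by split=> h v; rewrite -h xy.
Qed.

HB.instance Definition _ := gen_eqMixin equot.
HB.instance Definition _ := gen_choiceMixin equot.

End EvalQuotient.

(** The axioms are equations, apart from the coproduct axiom, which the explicit gluing formula
    turns into equations. A jointly injective family of maps compatible with the operations reflects
    them. *)
Lemma mackey_of_ev (gT : finGroupType) (M : gset gT -> zmodType)
    (res : forall X Y : gset gT, gmap X Y -> M Y -> M X)
    (tr : forall X Y : gset gT, gmap X Y -> M X -> M Y)
    (V : Type) (N : V -> gset gT -> zmodType)
    (nres : forall v (X Y : gset gT), gmap X Y -> N v Y -> N v X)
    (ntr : forall v (X Y : gset gT), gmap X Y -> N v X -> N v Y)
    (e : forall v X, M X -> N v X) :
  (forall v, mackey_axioms (nres v) (ntr v)) ->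
  (forall X a b, (forall v, e v X a = e v X b) -> a = b) ->
  (forall v X, {morph e v X : a b / a + b}) ->
  (forall v X Y (f : gmap X Y) a,
    e v X (res X Y f a) = nres v X Y f (e v Y a)) ->
  (forall v X Y (f : gmap X Y) a,
    e v Y (tr X Y f a) = ntr v X Y f (e v X a)) ->
  mackey_axioms res tr.
Proof.
move=> ax einj eD eres etr.
split.
- by move=> X Y f a b; apply: einj => v; rewrite eD !eres eD (mresD (ax v)).
- by move=> X Y f a b; apply: einj => v; rewrite eD !etr eD (mtrD (ax v)).
- by move=> X a; apply: einj => v; rewrite eres (mres_id (ax v)).
- by move=> X a; apply: einj => v; rewrite etr (mtr_id (ax v)).
- by move=> X Y Z g f a; apply: einj => v; rewrite !eres (mres_comp (ax v)).
- by move=> X Y Z g f a; apply: einj => v; rewrite !etr (mtr_comp (ax v)).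
- move=> X X0 a; apply: einj => v.
  by rewrite (mempty (ax v) X0 (e v X a)) (mempty (ax v) X0 (e v X 0)).
- move=> X Y Z i j ij a b; exists (tr _ _ i a + tr _ _ j b).
  split=> [|c [<- <-]].
    by split; apply: einj => v; rewrite eres eD !etr;
      have [] := mackey_glue (ax v) (e v X a) (e v Y b) ij.
  by apply: einj => v; rewrite eD !etr !eres (mackey_unglue (ax v)).
- move=> W X Y Z p q f g pb a; apply: einj => v.
  by rewrite !(eres, etr) (mpullback (ax v) pb).
Qed.

(** * Free polynomial algebras *)

Section FreePoly.
Variables (gT : finGroupType) (k : tambara gT) (n : nat) (X : 'I_n -> gset gT).

(** Zero and negatives come from [PConst], as the constant 0 and as products with the constant
    -1. *)
Inductive pterm : gcode gT -> Type :=
  | PVar i : pterm (genc (X i))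
  | PConst c (a : k (gdec c)) : pterm c
  | PAdd c (t u : pterm c) : pterm c
  | PMul c (t u : pterm c) : pterm c
  | PRes c d (f : gmap (gdec c) (gdec d)) (t : pterm d) : pterm c
  | PTr c d (f : gmap (gdec c) (gdec d)) (t : pterm c) : pterm d
  | PNm c d (f : gmap (gdec c) (gdec d)) (t : pterm c) : pterm d.

Record pval := PVal { pval_alg :> kalg k; pval_var : forall i, pval_alg (X i) }.

Fixpoint peval (v : pval) c (t : pterm c) : v (gdec c) :=
  match t in pterm c return v (gdec c) with
  | PVar i => tres (gfrom (X i)) (pval_var v i)
  | PConst c a => kalg_unit v (gdec c) a
  | PAdd c t u => peval v t + peval v u
  | PMul c t u => peval v t * peval v u
  | PRes c d f t => tres f (peval v t)
  | PTr c d f t => ttr f (peval v t)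
  | PNm c d f t => tnm f (peval v t)
  end.

(** Terms are identified when they agree in every k-algebra with chosen elements in the levels
    [X i]. Every identity valid in all k-algebras therefore holds here, which is how the axioms
    below are proved. *)
Definition fpoly Y := equot (fun v : pval => @peval v (genc Y)).

HB.instance Definition _ Y := Choice.on (fpoly Y).

Definition fpev (v : pval) Y (a : fpoly Y) : v Y := tres (gto Y) (qev v a).

Lemma fpev_inj Y (a b : fpoly Y) : (forall v, fpev v a = fpev v b) -> a = b.
Proof.
move=> ab; apply: qev_inj => v.
by apply: (mackey_gto_inj (tmackey v)); apply: ab.
Qed.

Lemma fpev_cls v Y (t : pterm (genc Y)) :
  fpev v (ecls _ t : fpoly Y) = tres (gto Y) (peval v t).
Proof. by rewrite /fpev qev_cls. Qed.

Definition fpoly_const Y (a : k Y) : fpoly Y :=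
  ecls _ (@PConst (genc Y) (tres (gfrom Y) a)).
Definition fpoly_add Y (a b : fpoly Y) : fpoly Y :=
  ecls _ (PAdd (erep a) (erep b)).
Definition fpoly_mul Y (a b : fpoly Y) : fpoly Y :=
  ecls _ (PMul (erep a) (erep b)).
Definition fpoly_res Y Z (f : gmap Y Z) (a : fpoly Z) : fpoly Y :=
  ecls _ (PRes (gencm f) (erep a)).
Definition fpoly_tr Y Z (f : gmap Y Z) (a : fpoly Y) : fpoly Z :=
  ecls _ (PTr (gencm f) (erep a)).
Definition fpoly_nm Y Z (f : gmap Y Z) (a : fpoly Y) : fpoly Z :=
  ecls _ (PNm (gencm f) (erep a)).

Lemma fpev_const v Y (a : k Y) : fpev v (fpoly_const a) = kalg_unit v Y a.
Proof. by rewrite fpev_cls /= tam_hom_res (mackey_gtoK (tmackey v)). Qed.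
Lemma fpev_add v Y (a b : fpoly Y) :
  fpev v (fpoly_add a b) = fpev v a + fpev v b.
Proof. by rewrite fpev_cls /= (mresD (tmackey v)). Qed.
Lemma fpev_mul v Y (a b : fpoly Y) :
  fpev v (fpoly_mul a b) = fpev v a * fpev v b.
Proof. by rewrite fpev_cls /= tresM. Qed.
Lemma fpev_res v Y Z (f : gmap Y Z) (a : fpoly Z) :
  fpev v (fpoly_res f a) = tres f (fpev v a).
Proof. by rewrite fpev_cls /= -!(mres_comp (tmackey v)) gencm_comm. Qed.
Lemma fpev_tr v Y Z (f : gmap Y Z) (a : fpoly Y) :
  fpev v (fpoly_tr f a) = ttr f (fpev v a).
Proof. by rewrite fpev_cls /= (mpullback (tmackey v) (gencm_pullback f)). Qed.
Lemma fpev_nm v Y Z (f : gmap Y Z) (a : fpoly Y) :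
  fpev v (fpoly_nm f a) = tnm f (fpev v a).
Proof. by rewrite fpev_cls /= (tnm_pullback (gencm_pullback f)). Qed.

Let fpevE := (fpev_const, fpev_add, fpev_mul, fpev_res, fpev_tr, fpev_nm).

Section Ring.
Variable Y : gset gT.
Implicit Types a b c : fpoly Y.

Fact fpoly_addA : associative (@fpoly_add Y).
Proof. by move=> a b c; apply: fpev_inj => v; rewrite !fpevE addrA. Qed.
Fact fpoly_addC : commutative (@fpoly_add Y).
Proof. by move=> a b; apply: fpev_inj => v; rewrite !fpevE addrC. Qed.
Fact fpoly_add0 : left_id (fpoly_const (0 : k Y)) (@fpoly_add Y).
Proof.
move=> a; apply: fpev_inj => v; rewrite !fpevE.
by rewrite (morphD0 (@tam_homD _ _ _ _ _)) add0r.
Qed.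
Fact fpoly_addN : left_inverse (fpoly_const (0 : k Y))
  (fpoly_mul (fpoly_const (- 1 : k Y))) (@fpoly_add Y).
Proof.
move=> a; apply: fpev_inj => v; rewrite !fpevE.
rewrite (morphDN (@tam_homD _ _ _ _ _)) (morphD0 (@tam_homD _ _ _ _ _)).
by rewrite tam_hom1 mulN1r addNr.
Qed.

HB.instance Definition _ := GRing.isZmodule.Build (fpoly Y)
  fpoly_addA fpoly_addC fpoly_add0 fpoly_addN.

Fact fpoly_mulA : associative (@fpoly_mul Y).
Proof. by move=> a b c; apply: fpev_inj => v; rewrite !fpevE mulrA. Qed.
Fact fpoly_mulC : commutative (@fpoly_mul Y).
Proof. by move=> a b; apply: fpev_inj => v; rewrite !fpevE mulrC. Qed.
Fact fpoly_mul1 : left_id (fpoly_const (1 : k Y)) (@fpoly_mul Y).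
Proof.
by move=> a; apply: fpev_inj => v; rewrite !fpevE tam_hom1 mul1r.
Qed.
Fact fpoly_mulD : left_distributive (@fpoly_mul Y) (@fpoly_add Y).
Proof. by move=> a b c; apply: fpev_inj => v; rewrite !fpevE mulrDl. Qed.

HB.instance Definition _ := GRing.Zmodule_isComPzRing.Build (fpoly Y)
  fpoly_mulA fpoly_mulC fpoly_mul1 fpoly_mulD.

End Ring.

Lemma fpevD v Y (a b : fpoly Y) : fpev v (a + b) = fpev v a + fpev v b.
Proof. exact: fpev_add. Qed.
Lemma fpevM v Y (a b : fpoly Y) : fpev v (a * b) = fpev v a * fpev v b.
Proof. exact: fpev_mul. Qed.
Lemma fpev1 v Y : fpev v (1 : fpoly Y) = 1.
Proof. by rewrite [LHS]fpev_const tam_hom1. Qed.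

Let fpE := (fpevD, fpevM, fpev1, fpevE).

Fact fpoly_mackey :
  mackey_axioms (M := fun Y => fpoly Y) fpoly_res fpoly_tr.
Proof.
apply: (mackey_of_ev (e := fpev) (fun v => tmackey v)).
- exact: fpev_inj.
- exact: fpevD.
- exact: fpev_res.
- exact: fpev_tr.
Qed.

Fact fpoly_res1 Y Z (f : gmap Y Z) : fpoly_res f 1 = 1.
Proof. by apply: fpev_inj => v; rewrite !fpE tres1. Qed.
Fact fpoly_resM Y Z (f : gmap Y Z) : {morph fpoly_res f : a b / a * b}.
Proof. by move=> a b; apply: fpev_inj => v; rewrite !fpE tresM. Qed.
Fact fpoly_frobenius Y Z (f : gmap Y Z) a b :
  fpoly_tr f (a * fpoly_res f b) = fpoly_tr f a * b.
Proof. by apply: fpev_inj => v; rewrite !fpE tfrobenius. Qed.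
Fact fpoly_nm1 Y Z (f : gmap Y Z) : fpoly_nm f 1 = 1.
Proof. by apply: fpev_inj => v; rewrite !fpE tnm1. Qed.
Fact fpoly_nmM Y Z (f : gmap Y Z) : {morph fpoly_nm f : a b / a * b}.
Proof. by move=> a b; apply: fpev_inj => v; rewrite !fpE tnmM. Qed.
Fact fpoly_nm_id Y (a : fpoly Y) : fpoly_nm (gid Y) a = a.
Proof. by apply: fpev_inj => v; rewrite !fpE tnm_id. Qed.
Fact fpoly_nm_comp X' Y Z (g : gmap Y Z) (f : gmap X' Y) a :
  fpoly_nm (gcomp g f) a = fpoly_nm g (fpoly_nm f a).
Proof. by apply: fpev_inj => v; rewrite !fpE tnm_comp. Qed.
Fact fpoly_nm_pullback W X' Y Z (p : gmap W X') (q : gmap W Y)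
    (f : gmap X' Z) (g : gmap Y Z) : is_pullback p q f g ->
  forall a, fpoly_res g (fpoly_nm f a) = fpoly_nm q (fpoly_res p a).
Proof.
by move=> pb a; apply: fpev_inj => v; rewrite !fpE (tnm_pullback pb).
Qed.
Fact fpoly_exponential A X' Y P E (f : gmap A X') (p : gmap X' Y)
    (q : gmap P Y) (p' : gmap E P) (ev : gmap E A) :
  is_exponential f p q p' ev ->
  forall a,
    fpoly_nm p (fpoly_tr f a) = fpoly_tr q (fpoly_nm p' (fpoly_res ev a)).
Proof.
by move=> ex a; apply: fpev_inj => v; rewrite !fpE (tnm_exponential ex).
Qed.

Definition fpoly_tambara : tambara gT :=
  @Tambara gT (fun Y => fpoly Y) fpoly_res fpoly_tr fpoly_nm
    fpoly_mackey fpoly_res1 fpoly_resM fpoly_frobenius fpoly_nm1 fpoly_nmM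
    fpoly_nm_id fpoly_nm_comp fpoly_nm_pullback fpoly_exponential.

Definition fpoly_unit : tam_hom k fpoly_tambara.
Proof.
apply: (@TamHom gT k fpoly_tambara (fun Y a => fpoly_const a : fpoly Y)).
- by move=> Y a b; apply: fpev_inj => v; rewrite !fpE tam_homD.
- by move=> Y a b; apply: fpev_inj => v; rewrite !fpE tam_homM.
- by [].
- by move=> Y Z f a; apply: fpev_inj => v; rewrite !fpE tam_hom_res.
- by move=> Y Z f a; apply: fpev_inj => v; rewrite !fpE tam_hom_tr.
- by move=> Y Z f a; apply: fpev_inj => v; rewrite !fpE tam_hom_nm.
Defined.

Definition free_poly : kalg k := KAlg fpoly_unit.

Definition free_poly_var i : free_poly (X i) := ecls _ (PVar i) : fpoly (X i).

Definition free_poly_eval (v : pval) : kalg_hom free_poly v.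
Proof.
apply: (@KAlgHom gT k free_poly v (@TamHom gT fpoly_tambara v
  (fun Y a => fpev v a) (@fpevD v) (@fpevM v) (@fpev1 v) (@fpev_res v)
  (@fpev_tr v) (@fpev_nm v))).
exact: fpev_const.
Defined.

Lemma free_poly_evalE (v : pval) i :
  free_poly_eval v (X i) (free_poly_var i) = pval_var v i.
Proof. by rewrite [LHS]fpev_cls /= (mackey_gtoK (tmackey v)). Qed.

(** The code [genc (gdec c)] is not convertible to [c], so the term is moved along the bijection
    [gfrom]. *)
Definition fpoly_term c (t : pterm c) : fpoly (gdec c) :=
  ecls _ (PRes (gfrom (gdec c)) t).

Lemma fpev_term v c (t : pterm c) : fpev v (fpoly_term t) = peval v t.
Proof. by rewrite fpev_cls /= (mackey_gtoK (tmackey v)). Qed.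

(** Induction on terms: a morphism of k-algebras commutes with each constructor, so its values on
    the variables determine it. *)
Lemma free_poly_hom_term (R : kalg k) (r : forall i, R (X i))
    (h : kalg_hom free_poly R) :
    (forall i, h (X i) (free_poly_var i) = r i) ->
  forall c (t : pterm c), h _ (fpoly_term t) = peval (PVal r) t.
Proof.
move=> hr c; elim=> {c} /=.
- move=> i; rewrite -hr -tam_hom_res; congr (h _ _); apply: fpev_inj => v.
  by rewrite fpev_term fpev_res fpev_cls /= (mackey_gtoK (tmackey v)).
- move=> c a; rewrite -(kalg_homP h); congr (h _ _); apply: fpev_inj => v.
  by rewrite fpev_term fpev_const.
- move=> c t <- u <-; rewrite -tam_homD; congr (h _ _).
  by apply: fpev_inj => v; rewrite fpevD !fpev_term.
- move=> c t <- u <-; rewrite -tam_homM; congr (h _ _).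
  by apply: fpev_inj => v; rewrite fpevM !fpev_term.
- move=> c d f t <-; rewrite -tam_hom_res; congr (h _ _).
  by apply: fpev_inj => v; rewrite fpev_res !fpev_term.
- move=> c d f t <-; rewrite -tam_hom_tr; congr (h _ _).
  by apply: fpev_inj => v; rewrite fpev_tr !fpev_term.
- move=> c d f t <-; rewrite -tam_hom_nm; congr (h _ _).
  by apply: fpev_inj => v; rewrite fpev_nm !fpev_term.
Qed.

Lemma free_polyP : is_free_poly free_poly_var.
Proof.
move=> R r; exists (free_poly_eval (PVal r)); split=> [i|h hr Y a] /=.
  exact: (free_poly_evalE (PVal r) i).
(* Each element is the class of a term, up to restriction along the bijection [gto]. *)
have {1}-> : a = fpoly_res (gto Y) (fpoly_term (erep a)).
  by apply: fpev_inj => v; rewrite fpev_res fpev_term.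
by rewrite [LHS](tam_hom_res h) (free_poly_hom_term hr).
Qed.

End FreePoly.

(** * Relative box products *)

Section BoxProduct.
Variables (gT : finGroupType) (k : tambara gT) (M N : kmod k).

Inductive bterm : gcode gT -> Type :=
  | BPure c (m : M (gdec c)) (n : N (gdec c)) : bterm c
  | BAdd c (t u : bterm c) : bterm c
  | BScale c (a : k (gdec c)) (t : bterm c) : bterm c
  | BRes c d (f : gmap (gdec c) (gdec d)) (t : bterm d) : bterm c
  | BTr c d (f : gmap (gdec c) (gdec d)) (t : bterm c) : bterm d.

Record bval := BVal {
  bval_mod :> kmod k;
  bval_fun : forall X, M X -> N X -> bval_mod X;
  bval_pairing : is_pairing bval_fun }.

Fixpoint beval (v : bval) c (t : bterm c) : v (gdec c) :=
  match t in bterm c return v (gdec c) with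
  | BPure c m n => bval_fun v m n
  | BAdd c t u => beval v t + beval v u
  | BScale c a t => a *: beval v t
  | BRes c d f t => mres f (beval v t)
  | BTr c d f t => mtr f (beval v t)
  end.

(** As for [fpoly], with evaluation in the targets of all k-bilinear pairings out of M and N. *)
Definition box_car X := equot (fun v : bval => @beval v (genc X)).

HB.instance Definition _ X := Choice.on (box_car X).

Definition bxev (v : bval) X (x : box_car X) : v X := mres (gto X) (qev v x).

Lemma bxev_inj X (x y : box_car X) : (forall v, bxev v x = bxev v y) -> x = y.
Proof.
move=> xy; apply: qev_inj => v.
by apply: (mackey_gto_inj (mmackey v)); apply: xy.
Qed.

Lemma bxev_cls v X (t : bterm (genc X)) :
  bxev v (ecls _ t : box_car X) = mres (gto X) (beval v t).
Proof. by rewrite /bxev qev_cls. Qed.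

Definition box_pure X (m : M X) (n : N X) : box_car X :=
  ecls _ (@BPure (genc X) (mres (gfrom X) m) (mres (gfrom X) n)).
Definition box_add X (x y : box_car X) : box_car X :=
  ecls _ (BAdd (erep x) (erep y)).
Definition box_scale X (a : k X) (x : box_car X) : box_car X :=
  ecls _ (@BScale (genc X) (tres (gfrom X) a) (erep x)).
Definition box_res X Y (f : gmap X Y) (x : box_car Y) : box_car X :=
  ecls _ (BRes (gencm f) (erep x)).
Definition box_tr X Y (f : gmap X Y) (x : box_car X) : box_car Y :=
  ecls _ (BTr (gencm f) (erep x)).

Lemma bxev_pure v X (m : M X) (n : N X) :
  bxev v (box_pure m n) = bval_fun v m n.
Proof.
by rewrite bxev_cls /= (pairing_res (bval_pairing v)) (mackey_gtoK (mmackey v)).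
Qed.
Lemma bxev_add v X (x y : box_car X) :
  bxev v (box_add x y) = bxev v x + bxev v y.
Proof. by rewrite bxev_cls /= (mresD (mmackey v)). Qed.
Lemma bxev_scale v X a (x : box_car X) :
  bxev v (box_scale a x) = a *: bxev v x.
Proof.
rewrite bxev_cls /= mresZ -(mres_comp (tmackey k)) gtoK.
by rewrite (mres_id (tmackey k)).
Qed.
Lemma bxev_res v X Y (f : gmap X Y) (x : box_car Y) :
  bxev v (box_res f x) = mres f (bxev v x).
Proof. by rewrite bxev_cls /= -!(mres_comp (mmackey v)) gencm_comm. Qed.
Lemma bxev_tr v X Y (f : gmap X Y) (x : box_car X) :
  bxev v (box_tr f x) = mtr f (bxev v x).
Proof. by rewrite bxev_cls /= (mpullback (mmackey v) (gencm_pullback f)). Qed.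

Let bxevE := (bxev_pure, bxev_add, bxev_scale, bxev_res, bxev_tr).

Section Lmodule.
Variable X : gset gT.
Implicit Types x y z : box_car X.

Fact box_addA : associative (@box_add X).
Proof. by move=> x y z; apply: bxev_inj => v; rewrite !bxevE addrA. Qed.
Fact box_addC : commutative (@box_add X).
Proof. by move=> x y; apply: bxev_inj => v; rewrite !bxevE addrC. Qed.
(** In the absence of a zero term, the pure tensor of 0 and 0 serves as zero: bilinearity sends it
    to 0 under every pairing. *)
Fact box_add0 : left_id (box_pure (0 : M X) (0 : N X)) (@box_add X).
Proof.
move=> x; apply: bxev_inj => v; rewrite !bxevE -[0 : M X](scale0r 0).
by rewrite (pairingZl (bval_pairing v)) scale0r add0r.
Qed.
Fact box_addN : left_inverse (box_pure (0 : M X) (0 : N X))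
  (box_scale (- 1 : k X)) (@box_add X).
Proof.
move=> x; apply: bxev_inj => v; rewrite !bxevE -[0 : M X](scale0r 0).
by rewrite (pairingZl (bval_pairing v)) scale0r scaleN1r addNr.
Qed.

HB.instance Definition _ := GRing.isZmodule.Build (box_car X)
  box_addA box_addC box_add0 box_addN.

Lemma bxevD v x y : bxev v (x + y) = bxev v x + bxev v y.
Proof. exact: bxev_add. Qed.

Fact box_scaleA a b x : box_scale a (box_scale b x) = box_scale (a * b) x.
Proof. by apply: bxev_inj => v; rewrite !bxevE scalerA. Qed.
Fact box_scale1 : left_id (1 : k X) (@box_scale X).
Proof. by move=> x; apply: bxev_inj => v; rewrite !bxevE scale1r. Qed.
Fact box_scaleDr : right_distributive (@box_scale X) +%R.
Proof.
by move=> a x y; apply: bxev_inj => v; rewrite !(bxevD, bxevE) scalerDr.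
Qed.
Fact box_scaleDl x : {morph (@box_scale X)^~ x : a b / a + b}.
Proof.
by move=> a b; apply: bxev_inj => v; rewrite !(bxevD, bxevE) scalerDl.
Qed.

HB.instance Definition _ := GRing.Zmodule_isLmodule.Build (k X) (box_car X)
  box_scaleA box_scale1 box_scaleDr box_scaleDl.

Lemma bxevZ v a x : bxev v (a *: x) = a *: bxev v x.
Proof. exact: bxev_scale. Qed.

End Lmodule.

Let bxE := (bxevD, bxevZ, bxevE).

Fact box_mackey : mackey_axioms (M := fun X => box_car X) box_res box_tr.
Proof.
apply: (mackey_of_ev (e := bxev) (fun v : bval => mmackey v)).
- exact: bxev_inj.
- by move=> v X; apply: bxevD.
- exact: bxev_res.
- exact: bxev_tr.
Qed.

Fact box_resZ X Y (f : gmap X Y) (a : k Y) (x : box_car Y) :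
  box_res f (a *: x) = tres f a *: box_res f x.
Proof. by apply: bxev_inj => v; rewrite !bxE mresZ. Qed.
Fact box_frobeniusl X Y (f : gmap X Y) (a : k X) (x : box_car Y) :
  box_tr f (a *: box_res f x) = ttr f a *: x.
Proof. by apply: bxev_inj => v; rewrite !bxE mfrobeniusl. Qed.
Fact box_frobeniusr X Y (f : gmap X Y) (a : k Y) (x : box_car X) :
  box_tr f (tres f a *: x) = a *: box_tr f x.
Proof. by apply: bxev_inj => v; rewrite !bxE mfrobeniusr. Qed.

Definition box : kmod k :=
  @KMod gT k (fun X => box_car X) box_res box_tr box_mackey
    box_resZ box_frobeniusl box_frobeniusr.

Definition box_mul X (m : M X) (n : N X) : box X := box_pure m n.

Fact box_mul_pairing : is_pairing box_mul.
Proof.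
split.
- move=> X m m' n; apply: bxev_inj => v.
  by rewrite !bxE (pairingDl (bval_pairing v)).
- move=> X m n n'; apply: bxev_inj => v.
  by rewrite !bxE (pairingDr (bval_pairing v)).
- move=> X a m n; apply: bxev_inj => v.
  by rewrite !bxE (pairingZl (bval_pairing v)).
- move=> X a m n; apply: bxev_inj => v.
  by rewrite !bxE (pairingZr (bval_pairing v)).
- move=> X Y f m n; apply: bxev_inj => v.
  by rewrite !bxE (pairing_res (bval_pairing v)).
- move=> X Y f m n; apply: bxev_inj => v.
  by rewrite !bxE (pairing_frobeniusl (bval_pairing v)).
- move=> X Y f m n; apply: bxev_inj => v.
  by rewrite !bxE (pairing_frobeniusr (bval_pairing v)).
Qed.

Definition box_eval (v : bval) : kmod_hom box v :=
  @KModHom gT k box v (fun X x => bxev v x)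
    (fun X => @bxevD X v) (fun X => @bxevZ X v) (@bxev_res v) (@bxev_tr v).

Definition box_term c (t : bterm c) : box_car (gdec c) :=
  ecls _ (BRes (gfrom (gdec c)) t).

Lemma bxev_term v c (t : bterm c) : bxev v (box_term t) = beval v t.
Proof. by rewrite bxev_cls /= (mackey_gtoK (mmackey v)). Qed.

Lemma box_hom_term (v : bval) (h : kmod_hom box v) :
    (forall X m n, h X (box_mul m n) = bval_fun v m n) ->
  forall c (t : bterm c), h _ (box_term t) = beval v t.
Proof.
move=> hv c; elim=> {c} /=.
- move=> c m n; rewrite -hv; congr (h _ _).
  by apply: bxev_inj => w; rewrite bxev_term bxev_pure.
- move=> c t <- u <-; rewrite -kmod_homD; congr (h _ _).
  by apply: bxev_inj => w; rewrite bxevD !bxev_term.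
- move=> c a t <-; rewrite -kmod_homZ; congr (h _ _).
  by apply: bxev_inj => w; rewrite bxevZ !bxev_term.
- move=> c d f t <-; rewrite -kmod_hom_res; congr (h _ _).
  by apply: bxev_inj => w; rewrite bxev_res !bxev_term.
- move=> c d f t <-; rewrite -kmod_hom_tr; congr (h _ _).
  by apply: bxev_inj => w; rewrite bxev_tr !bxev_term.
Qed.

Lemma boxP : is_box box_mul.
Proof.
split=> [|Q c cP]; first exact: box_mul_pairing.
pose v := BVal cP; exists (box_eval v); split=> [X m n|h hv X x] /=.
  exact: (bxev_pure v).
have {1}-> : x = box_res (gto X) (box_term (erep x)).
  by apply: bxev_inj => w; rewrite bxev_res bxev_term.
by rewrite [LHS](kmod_hom_res h) (@box_hom_term v h hv).
Qed.

End BoxProduct.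

(** * Induction and flatness *)

Section Products.
Variable gT : finGroupType.
Implicit Types X Y Z T : gset gT.

Definition gprod_act X T (u : X * T) a := (gact X u.1 a, gact T u.2 a).

Fact gprod_act1 X T : (@gprod_act X T)^~ 1%g =1 id.
Proof. by case=> x t; rewrite /gprod_act !act1. Qed.

Fact gprod_actM X T u : act_morph (@gprod_act X T) u.
Proof. by move=> a b; rewrite /gprod_act !actMin ?inE. Qed.

Definition gprod X T : gset gT :=
  GSet (TotalAction (@gprod_act1 X T) (@gprod_actM X T)).

Definition gfst X T : gmap (gprod X T) X :=
  @GMap gT (gprod X T) X (fun u => u.1) (fun u a => erefl (gact X u.1 a)).

Definition gsnd X T : gmap (gprod X T) T :=
  @GMap gT (gprod X T) T (fun u => u.2) (fun u a => erefl (gact T u.2 a)).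

Fact gprodm_subproof X Y T (f : gmap X Y) (u : gprod X T) a :
  (f (gact _ u a).1, (gact _ u a).2) = gact (gprod Y T) (f u.1, u.2) a.
Proof. by rewrite /= gmapJ. Qed.

Definition gprodm X Y T (f : gmap X Y) : gmap (gprod X T) (gprod Y T) :=
  @GMap gT (gprod X T) (gprod Y T) (fun u => (f u.1, u.2)) (gprodm_subproof f).

Lemma gprodm_id X T : gprodm T (gid X) = gid (gprod X T).
Proof. by apply: gmap_ext => -[]. Qed.

Lemma gprodm_comp X Y Z T (g : gmap Y Z) (f : gmap X Y) :
  gprodm T (gcomp g f) = gcomp (gprodm T g) (gprodm T f).
Proof. exact: gmap_ext. Qed.

Lemma gfst_gprodm X Y T (f : gmap X Y) :
  gcomp (gfst Y T) (gprodm T f) = gcomp f (gfst X T).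
Proof. exact: gmap_ext. Qed.

Lemma gsnd_gprodm X Y T (f : gmap X Y) :
  gcomp (gsnd Y T) (gprodm T f) = gsnd X T.
Proof. exact: gmap_ext. Qed.

Lemma gfst_pullback X Y T (f : gmap X Y) :
  is_pullback (gfst X T) (gprodm T f) f (gfst Y T).
Proof.
split=> // x [y t] /= <-; exists (x, t); split=> // -[x' t'] /= [->].
by move=> /(congr1 snd) /= ->.
Qed.

Lemma gprodm_fst_pullback X Y T (f : gmap X Y) :
  is_pullback (gprodm T f) (gfst X T) (gfst Y T) f.
Proof.
split=> // [[y t]] x /= ->; exists (x, t); split=> // -[x' t'] /= [[_ ->] ->].
by [].
Qed.

Lemma gprodm_pullback W X Y Z T (p : gmap W X) (q : gmap W Y)
    (f : gmap X Z) (g : gmap Y Z) :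
  is_pullback p q f g ->
  is_pullback (gprodm T p) (gprodm T q) (gprodm T f) (gprodm T g).
Proof.
move=> [comm univ]; split=> [w|[x t] [y t'] /= [/univ[w [[<- <-] u]] <-]].
  by rewrite /= comm.
exists (w, t); split=> // -[w' s] /= [[pw ->] [qw]].
by rewrite (u w').
Qed.

Lemma gprodm_coprod X Y Z T (i : gmap X Z) (j : gmap Y Z) :
  is_coprod i j -> is_coprod (gprodm T i) (gprodm T j).
Proof.
move=> [h hK Kh].
exists (fun u => match h u.1 with
  inl x => inl (x, u.2) | inr y => inr (y, u.2) end).
  by case=> -[x t] /=; rewrite ?(hK (inl x)) ?(hK (inr x)).
case=> z t /=; have := Kh z.
by case: (h z) => x /= <-.
Qed.

End Products.

Section Induced.
Variables (gT : finGroupType) (k : tambara gT) (N : kmod k) (T : gset gT).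

(** For T = G/H, the functor N(- x T) is restriction to H followed by induction back to G. *)
Definition ind_car (X : gset gT) : Type := N (gprod X T).

HB.instance Definition _ X := GRing.Zmodule.on (ind_car X).

Definition ind_scale X (a : k X) (n : ind_car X) : ind_car X :=
  tres (gfst X T) a *: (n : N (gprod X T)).

Fact ind_scaleA X a b (n : ind_car X) :
  ind_scale a (ind_scale b n) = ind_scale (a * b) n.
Proof. by rewrite /ind_scale scalerA tresM. Qed.
Fact ind_scale1 X : left_id (1 : k X) (@ind_scale X).
Proof. by move=> n; rewrite /ind_scale tres1 scale1r. Qed.
Fact ind_scaleDr X : right_distributive (@ind_scale X) +%R.
Proof. by move=> a n n'; rewrite /ind_scale scalerDr. Qed.
Fact ind_scaleDl X (n : ind_car X) :
  {morph (@ind_scale X)^~ n : a b / a + b}.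
Proof. by move=> a b; rewrite /ind_scale (mresD (tmackey k)) scalerDl. Qed.

HB.instance Definition _ X := GRing.Zmodule_isLmodule.Build (k X) (ind_car X)
  (@ind_scaleA X) (@ind_scale1 X) (@ind_scaleDr X) (@ind_scaleDl X).

Definition ind_res X Y (f : gmap X Y) (n : ind_car Y) : ind_car X :=
  mres (gprodm T f) n.
Definition ind_tr X Y (f : gmap X Y) (n : ind_car X) : ind_car Y :=
  mtr (gprodm T f) n.

Fact ind_mackey : mackey_axioms (M := fun X => ind_car X) ind_res ind_tr.
Proof.
have ax := mmackey N; split.
- by move=> X Y f a b; apply: (mresD ax).
- by move=> X Y f a b; apply: (mtrD ax).
- by move=> X a; rewrite /ind_res gprodm_id (mres_id ax).
- by move=> X a; rewrite /ind_tr gprodm_id (mtr_id ax).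
- by move=> X Y Z g f a; rewrite /ind_res gprodm_comp (mres_comp ax).
- by move=> X Y Z g f a; rewrite /ind_tr gprodm_comp (mtr_comp ax).
- by move=> X X0 a; apply: (mempty ax); rewrite card_prod X0.
- by move=> X Y Z i j ij a b; apply: (mcoprod ax); apply: gprodm_coprod.
- move=> W X Y Z p q f g pb a.
  exact: (mpullback ax (gprodm_pullback T pb)).
Qed.

Lemma tres_gfst X Y (f : gmap X Y) (a : k Y) :
  tres (gprodm T f) (tres (gfst Y T) a) = tres (gfst X T) (tres f a).
Proof. by rewrite -!(mres_comp (tmackey k)) gfst_gprodm. Qed.

Fact ind_resZ X Y (f : gmap X Y) (a : k Y) (n : ind_car Y) :
  ind_res f (a *: n) = tres f a *: ind_res f n.
Proof. by rewrite [LHS]mresZ tres_gfst. Qed.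
Fact ind_frobeniusl X Y (f : gmap X Y) (a : k X) (n : ind_car Y) :
  ind_tr f (a *: ind_res f n) = ttr f a *: n.
Proof.
by rewrite [LHS]mfrobeniusl -(mpullback (tmackey k) (gfst_pullback T f)).
Qed.
Fact ind_frobeniusr X Y (f : gmap X Y) (a : k Y) (n : ind_car X) :
  ind_tr f (tres f a *: n) = a *: ind_tr f n.
Proof.
rewrite -[RHS](mfrobeniusr (gprodm T f) (tres (gfst Y T) a)).
by rewrite tres_gfst.
Qed.

Definition ind : kmod k :=
  @KMod gT k (fun X => ind_car X) ind_res ind_tr ind_mackey
    ind_resZ ind_frobeniusl ind_frobeniusr.

End Induced.

Lemma kmod_hom0 (gT : finGroupType) (k : tambara gT) (M N : kmod k)
  (h : kmod_hom M N) X : h X 0 = 0.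
Proof. exact: (morphD0 (@kmod_homD _ _ _ _ h X)). Qed.

Lemma kmod_hom_sum (gT : finGroupType) (k : tambara gT) (M N : kmod k)
    (h : kmod_hom M N) X I (r : seq I) (P : pred I) F :
  h X (\sum_(i <- r | P i) F i) = \sum_(i <- r | P i) h X (F i).
Proof. exact: (morphD_sum (@kmod_homD _ _ _ _ h X)). Qed.

(** * Modules with a dual basis *)

Section DualBasis.
Variables (gT : finGroupType) (k : tambara gT) (M : kmod k) (T : gset gT).
Variables (r : nat) (m : 'I_r -> M T).
Variable phi : 'I_r -> forall X, M X -> k (gprod X T).

(* The phi i are k-linear maps from M to the k-module X |-> k (X x T), so
   that M is a direct summand of a sum of r copies of that module. *)
Record dual_basis : Prop := {
  dual_basisD : forall i X, {morph phi i (X := X) : a b / a + b};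
  dual_basisZ : forall i X (a : k X) u,
    phi i (a *: u) = tres (gfst X T) a * phi i u;
  dual_basis_res : forall i X Y (f : gmap X Y) u,
    phi i (mres f u) = tres (gprodm T f) (phi i u);
  dual_basis_tr : forall i X Y (f : gmap X Y) u,
    phi i (mtr f u) = ttr (gprodm T f) (phi i u);
  dual_basisK : forall X (u : M X),
    \sum_i mtr (gfst X T) (phi i u *: mres (gsnd X T) (m i)) = u }.

Hypothesis db : dual_basis.

(** The box product of X |-> k(X x T) with N is X |-> N(X x T); this is the pairing into it that the
    coordinate [phi i] induces. *)
Definition coord_pairing (N : kmod k) i X (u : M X) (n : N X) : ind N T X :=
  phi i u *: mres (gfst X T) n.

Lemma coord_pairingP N i : is_pairing (coord_pairing (N := N) i).
Proof.
rewrite /coord_pairing; split.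
- by move=> X u u' n; rewrite dual_basisD // [LHS]scalerDl.
- by move=> X u n n'; rewrite (mresD (mmackey N)) [LHS]scalerDr.
- by move=> X a u n; rewrite dual_basisZ // -[LHS]scalerA.
- by move=> X a u n; rewrite mresZ scalerA mulrC -scalerA.
- move=> X Y f u n; rewrite dual_basis_res // [RHS]mresZ.
  by rewrite -!(mres_comp (mmackey N)) gfst_gprodm.
- move=> X Y f u n; rewrite dual_basis_tr // -[RHS]mfrobeniusl.
  by rewrite -!(mres_comp (mmackey N)) gfst_gprodm.
- move=> X Y f u n; rewrite dual_basis_res // [LHS]mfrobeniusr.
  by rewrite (mpullback (mmackey N) (gfst_pullback T f)).
Qed.

Section Coinduce.
Variables (N Q : kmod k) (c : forall X, M X -> N X -> Q X).
Hypothesis cP : is_pairing c.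

(** The element [m i] of M(T) amounts to a map from X |-> k(X x T) to M. Its box product with N,
    followed by the map that [c] induces, is this map. *)
Definition coind i X (n : ind N T X) : Q X :=
  mtr (gfst X T) (c (mres (gsnd X T) (m i)) (n : N (gprod X T))).

Lemma coindD i X : {morph coind i (X := X) : a b / a + b}.
Proof. by move=> a b; rewrite /coind (pairingDr cP) (mtrD (mmackey Q)). Qed.

Lemma coind0 i X : coind i (0 : ind N T X) = 0.
Proof. exact: (morphD0 (@coindD i X)). Qed.

Lemma coindZ i X (a : k X) n : coind i (a *: n) = a *: coind i n.
Proof. by rewrite /coind (pairingZr cP) mfrobeniusr. Qed.

Lemma coind_res i X Y (f : gmap X Y) n :
  coind i (mres f n) = mres f (coind i n).
Proof.
rewrite /coind (mpullback (mmackey Q) (gprodm_fst_pullback T f)).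
by rewrite -(pairing_res cP) -(mres_comp (mmackey M)) gsnd_gprodm.
Qed.

Lemma coind_tr i X Y (f : gmap X Y) n :
  coind i (mtr f n) = mtr f (coind i n).
Proof.
rewrite /coind -(mtr_comp (mmackey Q)) -gfst_gprodm (mtr_comp (mmackey Q)).
by rewrite -(gsnd_gprodm T f) (mres_comp (mmackey M)) (pairing_frobeniusr cP).
Qed.

(** Expand [u] by [dual_basisK], move the coefficients to the second argument of [c], and take the
    transfer out by Frobenius reciprocity. *)
Lemma coind_coord X (u : M X) (n : N X) :
  \sum_i coind i (coord_pairing i u n) = c u n.
Proof.
rewrite -[in RHS](dual_basisK db u).
rewrite (morphD_sum (fun u v => pairingDl cP u v n)).
apply: eq_bigr => i _ /=; rewrite /coind (pairingZr cP).
by rewrite -(pairingZl cP) (pairing_frobeniusl cP).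
Qed.

Variables (P : kmod k) (theta : 'I_r -> kmod_hom P (ind N T)).

Definition coind_sum_fun X (p : P X) : Q X := \sum_i coind i (theta i X p).

Fact coind_sumD X : {morph coind_sum_fun (X := X) : p q / p + q}.
Proof.
move=> p q; rewrite -big_split; apply: eq_bigr => i _.
by rewrite kmod_homD coindD.
Qed.

Fact coind_sumZ X (a : k X) p : coind_sum_fun (a *: p) = a *: coind_sum_fun p.
Proof.
by rewrite scaler_sumr; apply: eq_bigr => i _; rewrite kmod_homZ coindZ.
Qed.

Fact coind_sum_res X Y (f : gmap X Y) p :
  coind_sum_fun (mres f p) = mres f (coind_sum_fun p).
Proof.
rewrite (morphD_sum (mresD (mmackey Q) f)).
by apply: eq_bigr => i _; rewrite kmod_hom_res coind_res.
Qed.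

Fact coind_sum_tr X Y (f : gmap X Y) p :
  coind_sum_fun (mtr f p) = mtr f (coind_sum_fun p).
Proof.
rewrite (morphD_sum (mtrD (mmackey Q) f)).
by apply: eq_bigr => i _; rewrite kmod_hom_tr coind_tr.
Qed.

Definition coind_sum : kmod_hom P Q :=
  KModHom coind_sumD coind_sumZ coind_sum_res coind_sum_tr.

End Coinduce.

(** A criterion for a given pairing to be universal, applied later to [fp_square]. A pairing [c]
    factors through the coordinates [theta] by [coind_coord]. The factorisation is unique because
    the second hypothesis writes every element of P as a sum of transfers of values of [b]. *)
Lemma box_of_dual_basis (N P : kmod k) (b : forall X, M X -> N X -> P X)
    (bP : is_pairing b) (theta : 'I_r -> kmod_hom P (ind N T)) :
  (forall i X u n, theta i X (b X u n) = coord_pairing i u n) ->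
  (forall X p, coind_sum bP theta X p = p) ->
  is_box b.
Proof.
move=> thb thK; split=> // Q c cP; exists (coind_sum cP theta).
split=> /= [X u n|h hb X p].
  by rewrite -(coind_coord cP); apply: eq_bigr => i _; rewrite thb.
rewrite -[p in LHS]thK kmod_hom_sum.
apply: eq_bigr => i _ /=; rewrite /coind kmod_hom_tr.
by congr (mtr _ _); apply: hb.
Qed.

Definition kmod_hom_id (N : kmod k) : kmod_hom N N :=
  @KModHom gT k N N (fun X x => x) (fun _ _ _ => erefl) (fun _ _ _ => erefl)
    (fun _ _ _ _ => erefl) (fun _ _ _ _ => erefl).

Definition kmod_hom_comp (N1 N2 N3 : kmod k) (g : kmod_hom N2 N3)
    (f : kmod_hom N1 N2) : kmod_hom N1 N3.
Proof.
apply: (@KModHom gT k N1 N3 (fun X x => g X (f X x))).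
- by move=> X x y; rewrite !kmod_homD.
- by move=> X a x; rewrite !kmod_homZ.
- by move=> X Y h x; rewrite !kmod_hom_res.
- by move=> X Y h x; rewrite !kmod_hom_tr.
Defined.

Definition ind_hom (N1 N2 : kmod k) (f : kmod_hom N1 N2) :
    kmod_hom (ind N1 T) (ind N2 T) :=
  @KModHom gT k (ind N1 T) (ind N2 T) (fun X => f (gprod X T))
    (fun X => @kmod_homD _ _ _ _ f (gprod X T))
    (fun X a => @kmod_homZ _ _ _ _ f (gprod X T) (tres (gfst X T) a))
    (fun X Y h => @kmod_hom_res _ _ _ _ f _ _ (gprodm T h))
    (fun X Y h => @kmod_hom_tr _ _ _ _ f _ _ (gprodm T h)).

(** Restricted to pure tensors, [g] is a pairing, and both maps factor it. *)
Lemma box_hom_ext (N Q : kmod k) (f g : kmod_hom (box M N) Q) :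
    (forall X u n, f X (box_mul u n) = g X (box_mul u n)) ->
  forall X x, f X x = g X x.
Proof.
move=> fg X x.
have cP : is_pairing (fun X u n => g X (@box_mul _ _ M N X u n)).
  have [bDl bDr bZl bZr bres btl btr] := box_mul_pairing M N.
  split=> *.
  - by rewrite bDl kmod_homD.
  - by rewrite bDr kmod_homD.
  - by rewrite bZl kmod_homZ.
  - by rewrite bZr kmod_homZ.
  - by rewrite bres kmod_hom_res.
  - by rewrite -btl kmod_hom_tr.
  - by rewrite -btr kmod_hom_tr.
have [h [_ hU]] := box_univ (boxP M N) cP.
by rewrite (hU f fg) (hU g).
Qed.

Definition box_coord (N : kmod k) i : kmod_hom (box M N) (ind N T) :=
  box_eval (BVal (coord_pairingP N i)).

Lemma box_coordE N i X u n :
  box_coord N i X (box_mul u n) = coord_pairing i u n.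
Proof. exact: (bxev_pure (BVal (coord_pairingP N i))). Qed.

(** Pure tensors suffice, and there this is [coind_coord]. So [box M N] is a direct summand of r
    copies of [ind N T]; the next section shows that this is natural in N. *)
Lemma box_coordK N X x :
  coind_sum (box_mul_pairing M N) (box_coord N) X x = x.
Proof.
apply: (box_hom_ext (g := kmod_hom_id (box M N))) => {x}X u n /=.
rewrite -[RHS](coind_coord (box_mul_pairing M N)).
by apply: eq_bigr => i _; rewrite box_coordE.
Qed.

Section Functoriality.
Variables (N1 N2 : kmod k) (f : kmod_hom N1 N2).
Variable Bf : kmod_hom (box M N1) (box M N2).
Hypothesis BfE : forall X m n, Bf X (box_mul m n) = box_mul m (f X n).

Lemma box_coord_nat i X x :
  box_coord N2 i X (Bf X x) = ind_hom f X (box_coord N1 i X x).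
Proof.
apply: (box_hom_ext (f := kmod_hom_comp (box_coord N2 i) Bf)
  (g := kmod_hom_comp (ind_hom f) (box_coord N1 i))) => {x}X u n.
rewrite -[LHS]/(box_coord N2 i X (Bf X _)) BfE box_coordE.
rewrite -[RHS]/(ind_hom f X (box_coord N1 i X _)) box_coordE.
by rewrite [RHS]kmod_homZ kmod_hom_res.
Qed.

Lemma coind_nat i X (n : ind N1 T X) :
  Bf X (coind (@box_mul _ _ M N1) i n) =
  coind (@box_mul _ _ M N2) i (ind_hom f X n).
Proof. by rewrite /coind kmod_hom_tr BfE. Qed.

End Functoriality.

(** Exactness of a sequence passes to its evaluations at X x T, hence to the natural direct summand
    [box M N]. *)
Lemma flat_of_dual_basis : flat M.
Proof.
exists (box M), (fun N => @box_mul gT k M N).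
split=> [|N1 N2 N3 f g Bf Bg BfE BgE]; first exact: boxP.
case=> finj fmid gsurj.
split=> [X x Bfx0|X x|X x].
- rewrite -[x]box_coordK; apply: big1 => i _.
  have -> : box_coord N1 i X x = 0.
    apply: finj; have := box_coord_nat BfE i x.
    by rewrite Bfx0 kmod_hom0.
  exact: (coind0 (box_mul_pairing M N1)).
- split=> [Bgx0|[y <-]].
    (* Exactness in level X x T lifts the coordinates one by one; [coind] reassembles the lifts. *)
    have /choice[y yP] i : exists y, f _ y = box_coord N2 i X x.
      apply/fmid; have := box_coord_nat BgE i x.
      by rewrite Bgx0 kmod_hom0.
    exists (\sum_i coind (@box_mul _ _ M N1) i (y i)).
    rewrite kmod_hom_sum -[RHS]box_coordK.
    by apply: eq_bigr => i _; rewrite (coind_nat BfE) -yP.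
  rewrite -[LHS]box_coordK; apply: big1 => i _.
  rewrite (box_coord_nat BgE) (box_coord_nat BfE) /=.
  have /fmid -> : exists z, f _ z =
      f (gprod X T) (bxev (BVal (coord_pairingP N1 i)) y).
    by eexists.
  exact: (coind0 (box_mul_pairing M N3)).
- have /choice[y yP] i : exists y, g _ y = box_coord N3 i X x by apply: gsurj.
  exists (\sum_i coind (@box_mul _ _ M N2) i (y i)).
  rewrite kmod_hom_sum -[RHS]box_coordK.
  by apply: eq_bigr => i _; rewrite (coind_nat BgE) -yP.
Qed.

End DualBasis.

(** * Orbits, kernels and finite presentation *)

Lemma tam_hom0 (gT : finGroupType) (T U : tambara gT) (h : tam_hom T U) X :
  h X 0 = 0.
Proof. exact: (morphD0 (@tam_homD _ _ _ h X)). Qed.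

Lemma tam_homB (gT : finGroupType) (T U : tambara gT) (h : tam_hom T U) X :
  {morph h X : a b / a - b}.
Proof. exact: (morphDB (@tam_homD _ _ _ h X)). Qed.

Lemma tam_hom_sum (gT : finGroupType) (T U : tambara gT) (h : tam_hom T U) X
    I (r : seq I) (P : pred I) F :
  h X (\sum_(i <- r | P i) F i) = \sum_(i <- r | P i) h X (F i).
Proof. exact: (morphD_sum (@tam_homD _ _ _ h X)). Qed.

Section Orbits.
Variable gT : finGroupType.

Fact unit_act1 : (fun (x : unit) (_ : gT) => x)^~ 1%g =1 id.
Proof. by []. Qed.

Definition gunit : gset gT :=
  GSet (TotalAction unit_act1 (fun x _ _ => erefl x)).

Definition gto_unit (X : gset gT) : gmap X gunit :=
  @GMap gT X gunit (fun=> tt) (fun _ _ => erefl tt).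

Lemma gunit_orbit : is_orbit gunit.
Proof.
apply/imsetP; exists tt => //; apply/setP => -[]; rewrite inE.
by apply/esym/imsetP; exists 1%g.
Qed.

(** The free orbit G/e; the points of X give maps from it to X, by [gorbit]. *)
Definition greg : gset gT := GSet (mulgr_action gT).

Definition gorbit (X : gset gT) (x : X) : gmap greg X :=
  @GMap gT greg X (gact X x)
    (fun a b => actMin (gact X) x (in_setT a) (in_setT b)).

End Orbits.

Section Kernels.
Variables (gT : finGroupType) (k : tambara gT).

(** If the kernel I is contained in I^{>1}, the quotient has a single coset. *)
Lemma kahler_zero_of_gt1 (P R : kalg k) (i j : kalg_hom R P)
    (mu : kalg_hom P R) :
  is_box_alg i j -> (forall X r, mu X (i X r) = r) ->
  (forall X r, mu X (j X r) = r) ->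
  (forall X a, tker mu a -> ideal_gt1 (@tker _ _ _ mu) (X := X) a) ->
  kahler_zero R.
Proof.
move=> box_ij mui muj gt1; exists P, i, j, mu; split=> // X w [a a0 ->].
rewrite /tcoset predeqE => b; rewrite subr0.
(* Every ideal over which the intersection [ideal_gt1] is taken contains [a]. *)
have hab I : is_ideal I ->
    (forall Y c, ideal_gt1_gens (@tker _ _ _ mu) c -> I Y c) ->
    I X (b - a) <-> I X b.
  move=> Iid gen; have := gt1 X a a0 I Iid gen.
  case: Iid => U [h hI]; rewrite !hI /tker tam_homB => ->.
  by rewrite subr0.
by split=> ab I Iid gen;
  [apply (hab I Iid gen).1 | apply (hab I Iid gen).2]; apply: ab.
Qed.

Definition tam_hom_comp (R S T : tambara gT) (g : tam_hom S T)
  (f : tam_hom R S) : tam_hom R T.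
Proof.
apply: (@TamHom gT R T (fun X a => g X (f X a))).
- by move=> X a b; rewrite !tam_homD.
- by move=> X a b; rewrite !tam_homM.
- by move=> X; rewrite !tam_hom1.
- by move=> X Y h a; rewrite !tam_hom_res.
- by move=> X Y h a; rewrite !tam_hom_tr.
- by move=> X Y h a; rewrite !tam_hom_nm.
Defined.

Definition kalg_hom_comp (R S T : kalg k) (g : kalg_hom S T)
  (f : kalg_hom R S) : kalg_hom R T.
Proof.
apply: (@KAlgHom gT k R T (tam_hom_comp g f)) => X a.
by rewrite /= !kalg_homP.
Defined.

Lemma tker_ideal (T U : tambara gT) (h : tam_hom T U) :
  is_ideal (@tker _ _ _ h).
Proof. by exists U, h. Qed.

Section Factor.
Variables (P R T : kalg k) (q : kalg_hom P R) (f : kalg_hom P T).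
Hypothesis q_surj : forall X a, exists b, q X b = a.
Hypothesis kerqf : forall X b, tker q b -> tker f (X := X) b.

(** A preimage is chosen; [kerqf] makes the value independent of the choice. *)
Definition factor_fun X (a : R X) : T X := f X (sval (cid (q_surj a))).

Lemma factor_funE X b : factor_fun (q X b) = f X b.
Proof.
rewrite /factor_fun; case: cid => c /= qc.
apply/eqP; rewrite -subr_eq0 -tam_homB.
by apply/eqP/kerqf; rewrite /tker tam_homB qc subrr.
Qed.

Definition factor_tam : tam_hom R T.
Proof.
apply: (@TamHom gT R T factor_fun).
- move=> X a b; have [[a' <-] [b' <-]] := (q_surj a, q_surj b).
  by rewrite -tam_homD !factor_funE tam_homD.
- move=> X a b; have [[a' <-] [b' <-]] := (q_surj a, q_surj b).
  by rewrite -tam_homM !factor_funE tam_homM.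
- by move=> X; rewrite -(tam_hom1 q) factor_funE tam_hom1.
- move=> X Y g a; have [a' <-] := q_surj a.
  by rewrite -tam_hom_res !factor_funE tam_hom_res.
- move=> X Y g a; have [a' <-] := q_surj a.
  by rewrite -tam_hom_tr !factor_funE tam_hom_tr.
- move=> X Y g a; have [a' <-] := q_surj a.
  by rewrite -tam_hom_nm !factor_funE tam_hom_nm.
Defined.

Definition factor : kalg_hom R T.
Proof.
apply: (@KAlgHom gT k R T factor_tam) => X a /=.
by rewrite -(kalg_homP q) factor_funE kalg_homP.
Defined.

End Factor.

(** Surjectivity presents R as the quotient of P by the kernel of [q], which finitely many [z i]
    generate. The maps [u] and [v] send the free generators to the [z i] and to 0, so that
    coequalizing them means killing this kernel. *)
Lemma hilbert_finitely_presented (R : kalg k) (n : nat) (X : 'I_n -> gset gT)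
    (x : forall i, R (X i)) :
  (forall Y (a : R Y), exists b, free_poly_eval (PVal x) Y b = a) ->
  hilbert_basis k -> finitely_presented R.
Proof.
move=> q_surj hk; pose P := free_poly k X.
pose q : kalg_hom P R := free_poly_eval (PVal x).
have [m [Z [z kerq]]] := hk n X P _ (@free_polyP gT k n X) _ (tker_ideal q).
have zmem i : q (Z i) (z i) = 0 by apply/kerq => I _; apply.
have freeQ := @free_polyP gT k m Z.
have [u [uy _]] := freeQ P z; have [v [vy _]] := freeQ P (fun i => 0).
exists m, Z, (free_poly k Z), (free_poly_var k Z), n, X, P, (free_poly_var k X).
exists u, v, q; split; first exact: freeQ; first exact: free_polyP.
split=> [Y a|T f fuv].
  (* [g] is the morphism sending all free generators to 0; both composites agree with it on
     generators. *)
  have [g [_ gU]] := freeQ R (fun i => 0).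
  transitivity (g Y a); [|symmetry].
    apply: (gU (kalg_hom_comp q u)) => i.
    by apply: etrans (congr1 (q _) (uy i)) _.
  apply: (gU (kalg_hom_comp q v)) => i.
  by apply: etrans (congr1 (q _) (vy i)) (tam_hom0 _ _).
(* The kernel of [f] is an ideal containing each [z i], so it contains the ideal they generate. *)
have kerqf Y b : tker q b -> tker f (X := Y) b.
  move=> /kerq; apply; first exact: tker_ideal.
  by move=> W c; case=> i; rewrite /tker -uy fuv vy tam_hom0.
exists (factor q_surj kerqf).
split=> [Y a|g gE Y a] /=; first exact: factor_funE.
by have [b <-] := q_surj Y a; rewrite [RHS](factor_funE q_surj kerqf) gE.
Qed.

End Kernels.

Lemma big_gfst (R : Type) (idx : R) (op : Monoid.com_law idx)
    (gT : finGroupType) (X T : gset gT) x (F : gprod X T -> R) :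
  \big[op/idx]_(u | gfst X T u == x) F u = \big[op/idx]_t F (x, t).
Proof.
rewrite (reindex_onto (fun t => (x, t)) snd) => [|[y t] /eqP <- //].
by apply: eq_bigl => t; rewrite /= !eqxx.
Qed.

Lemma big_gprodm (R : Type) (idx : R) (op : Monoid.com_law idx)
    (gT : finGroupType) (X Y T : gset gT) (f : gmap X Y) y t
    (F : gprod X T -> R) :
  \big[op/idx]_(u | gprodm T f u == (y, t)) F u =
  \big[op/idx]_(x | f x == y) F (x, t).
Proof.
rewrite (reindex_onto (fun x => (x, t)) fst) => [|[x t'] /eqP[_ ->] //].
by apply: eq_bigl => x; rewrite xpair_eqE !eqxx !andbT.
Qed.

Lemma fp_sumE (gT : finGroupType) (S : comPzRingType) (s : ring_action gT S)
    (X : gset gT) I (J : seq I) (P : pred I) (F : I -> fp s X) x :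
  (\sum_(i <- J | P i) F i) x = \sum_(i <- J | P i) F i x.
Proof.
by apply: (big_morph (fun f : fp s X => f x)) => [f g|]; rewrite ffunE.
Qed.

(** * Galois extensions *)

Fact ffun_pz_mulC (aT : finType) (S : comPzRingType) :
  commutative (@GRing.mul {ffun aT -> S}).
Proof. by move=> f g; apply/ffunP => x; rewrite !ffunE mulrC. Qed.

HB.instance Definition _ (aT : finType) (S : comPzRingType) :=
  GRing.PzRing_hasCommutativeMul.Build {ffun aT -> S} (@ffun_pz_mulC aT S).

Lemma kalg_pairing (gT : finGroupType) (k : tambara gT) (R S P : kalg k)
    (i : kalg_hom R P) (j : kalg_hom S P) :
  @is_pairing gT k (kalg_mod R) (kalg_mod S) (kalg_mod P)
    (fun X (a : R X) (b : S X) => (i X a * j X b : P X)).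
Proof.
split=> /=.
- by move=> X a a' b; rewrite tam_homD mulrDl.
- by move=> X a b b'; rewrite tam_homD mulrDr.
- by move=> X c a b; rewrite tam_homM kalg_homP -mulrA.
- by move=> X c a b; rewrite tam_homM kalg_homP mulrCA.
- by move=> X Y f a b; rewrite !tam_hom_res -tresM.
- by move=> X Y f a b; rewrite tam_hom_res tam_hom_tr tfrobenius.
- by move=> X Y f a b; rewrite tam_hom_res tam_hom_tr mulrC tfrobenius mulrC.
Qed.

(* If L is Galois over K with group G, then L (x)_K L is isomorphic to the ring
   of all functions G -> L by x (x) y |-> (g |-> x * g(y)); the action below
   corresponds to the diagonal one. *)
Section GaloisSquare.
Variables (gT : finGroupType) (L : comPzRingType) (s : ring_action gT L).

Definition square_act (a : gT) (p : {ffun gT -> L}) : {ffun gT -> L} :=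
  [ffun g => s a (p (a * g * a^-1)%g)].

Fact square_act_zmod a : zmod_morphism (square_act a).
Proof. by move=> p q; apply/ffunP => g; rewrite !ffunE rmorphB. Qed.

Fact square_act_monoid a : monoid_morphism (square_act a).
Proof.
split=> [|p q]; apply/ffunP => g; rewrite !ffunE ?rmorph1 //.
by rewrite rmorphM.
Qed.

HB.instance Definition _ a :=
  GRing.isZmodMorphism.Build _ _ (square_act a) (square_act_zmod a).
HB.instance Definition _ a :=
  GRing.isMonoidMorphism.Build _ _ (square_act a) (square_act_monoid a).

Fact square_act1 p : square_act 1%g p = p.
Proof. by apply/ffunP => g; rewrite ffunE ract1 mul1g invg1 mulg1. Qed.

Fact square_actM a b p : square_act (a * b)%g p = square_act b (square_act a p).
Proof. by apply/ffunP => g; rewrite !ffunE ractM invMg !mulgA. Qed.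

Definition square_action : ring_action gT {ffun gT -> L} :=
  @RingAction gT {ffun gT -> L} square_act square_act1 square_actM.

Definition square_inl (y : L) : {ffun gT -> L} := [ffun=> y].
Definition square_inr (y : L) : {ffun gT -> L} := [ffun g => s g y].
(** The product of x and y is the value of g |-> x g(y) at 1. *)
Definition square_mul (p : {ffun gT -> L}) : L := p 1%g.

Fact square_inl_zmod : zmod_morphism square_inl.
Proof. by move=> x y; apply/ffunP => g; rewrite !ffunE. Qed.
Fact square_inl_monoid : monoid_morphism square_inl.
Proof. by split=> [|x y]; apply/ffunP => g; rewrite !ffunE. Qed.
HB.instance Definition _ :=
  GRing.isZmodMorphism.Build _ _ square_inl square_inl_zmod.
HB.instance Definition _ :=
  GRing.isMonoidMorphism.Build _ _ square_inl square_inl_monoid.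

Fact square_inr_zmod : zmod_morphism square_inr.
Proof. by move=> x y; apply/ffunP => g; rewrite !ffunE rmorphB. Qed.
Fact square_inr_monoid : monoid_morphism square_inr.
Proof.
by split=> [|x y]; apply/ffunP => g; rewrite !ffunE ?rmorph1 ?rmorphM.
Qed.
HB.instance Definition _ :=
  GRing.isZmodMorphism.Build _ _ square_inr square_inr_zmod.
HB.instance Definition _ :=
  GRing.isMonoidMorphism.Build _ _ square_inr square_inr_monoid.

Fact square_mul_zmod : zmod_morphism square_mul.
Proof. by move=> p q; rewrite /square_mul !ffunE. Qed.
Fact square_mul_monoid : monoid_morphism square_mul.
Proof. by split=> [|p q]; rewrite /square_mul !ffunE. Qed.
HB.instance Definition _ :=
  GRing.isZmodMorphism.Build _ _ square_mul square_mul_zmod.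
HB.instance Definition _ :=
  GRing.isMonoidMorphism.Build _ _ square_mul square_mul_monoid.

Lemma square_inlJ a y : square_inl (s a y) = square_action a (square_inl y).
Proof. by apply/ffunP => g; rewrite !ffunE. Qed.

Lemma square_inrJ a y : square_inr (s a y) = square_action a (square_inr y).
Proof. by apply/ffunP => g; rewrite !ffunE -!ractM mulgKV. Qed.

Lemma square_mulJ a p : square_mul (square_action a p) = s a (square_mul p).
Proof. by rewrite /square_mul ffunE mulg1 mulgV. Qed.

End GaloisSquare.

(** * Trace forms, dual bases and flatness of FP(L) *)

Section GaloisRing.
Variables (gT : finGroupType) (K L : comPzRingType) (s : ring_action gT L).
Variable h : {rmorphism K -> L}.
Hypothesis hJ : forall a x, h (trivial_action gT K a x) = s a (h x).
Hypothesis h_inj : injective h.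
Hypothesis fixedP : forall y, (forall a, s a y = y) -> exists c, h c = y.
Variables (r : nat) (w d : 'I_r -> L).
Hypothesis dualP : forall g, \sum_i s g (w i) * d i = (g == 1%g)%:R.

Let k := constT gT K.
Let R : kalg k := KAlg (FP_map hJ).
Let G := greg gT.

Fact trace_fixed y a : s a (\sum_g s g y) = \sum_g s g y.
Proof.
rewrite rmorph_sum [RHS](reindex_inj (mulIg a)).
by apply: eq_bigr => g _; rewrite ractM.
Qed.

Definition trace y : K := sval (cid (fixedP (trace_fixed y))).

Lemma traceE y : h (trace y) = \sum_g s g y.
Proof. exact: (svalP (cid (fixedP (trace_fixed y)))). Qed.

Lemma traceD : {morph trace : y z / y + z}.
Proof.
move=> y z; apply: h_inj; rewrite rmorphD !traceE -big_split.
by apply: eq_bigr => g _; rewrite rmorphD.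
Qed.

Lemma traceZ c y : trace (h c * y) = c * trace y.
Proof.
apply: h_inj; rewrite rmorphM !traceE mulr_sumr; apply: eq_bigr => g _.
by rewrite rmorphM -hJ.
Qed.

(** This is [dualP] at g b^-1, transported by [b]. *)
Lemma dual_gal g b : \sum_i s g (w i) * s b (d i) = (g == b)%:R.
Proof.
have -> : g = (g * b^-1 * b)%g by rewrite mulgKV.
under eq_bigr do rewrite ractM -rmorphM.
rewrite -rmorph_sum dualP rmorph_nat mulgKV; congr (_%:R).
by rewrite -(inj_eq (mulIg b)) mulgKV mul1g.
Qed.

(** The left side is the sum over g and i of g(d_i) g(y) w_i, and by [dual_gal] only g = 1
    survives. *)
Lemma trace_expand y : \sum_i h (trace (d i * y)) * w i = y.
Proof.
transitivity (\sum_g s g y * (1%g == g)%:R).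
  under [RHS]eq_bigr do rewrite -dual_gal mulr_sumr.
  rewrite exchange_big; apply: eq_bigr => i _.
  rewrite traceE mulr_suml; apply: eq_bigr => g _.
  by rewrite rmorphM ract1 mulrAC mulrC [X in _ * X]mulrC.
rewrite (bigD1 1%g) //= eqxx mulr1 ract1 big1 ?addr0 // => g.
by rewrite eq_sym => /negPf ->; rewrite mulr0.
Qed.

Variable e : L.
Hypothesis trace1 : \sum_g s g e = 1.

(** By [dual_gal], summing b(d_i) g(w_i) over i kills the terms with b different from g. The
    reconstruction formulas for FP(L) and for its box square both reduce to this. *)
Lemma dual_collapse (F : gT -> gT -> L) :
  \sum_i \sum_g (\sum_b s b (d i) * F g b) * s g (e * w i) =
  \sum_g s g e * F g g.
Proof.
rewrite exchange_big; apply: eq_bigr => g _.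
transitivity (\sum_b s g e * F g b * (g == b)%:R).
  under [RHS]eq_bigr do rewrite -dual_gal mulr_sumr.
  rewrite exchange_big; apply: eq_bigr => i _.
  rewrite mulr_suml; apply: eq_bigr => b _; rewrite rmorphM.
  by rewrite mulrACA [X in X * _]mulrC mulrACA [X in _ * X]mulrC.
rewrite (bigD1 g) //= eqxx mulr1 big1 ?addr0 // => b.
by rewrite eq_sym => /negPf ->; rewrite mulr0.
Qed.

Fact reg_elt_subproof l : [ffun g => s g l] \in fp_pred s G.
Proof. by apply/fp_predP => g a; rewrite !ffunE /= ractM. Qed.

(** Evaluation at 1 identifies FP(L)(G/e) with L; this is the inverse. *)
Definition reg_elt (l : L) : R G := Fp (reg_elt_subproof l).

(** The twist by the inverse of the G-coordinate cancels the action on the values of [u], so the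
    result is invariant under G. *)
Fact coordf_subproof i X (u : R X) :
  [ffun v : gprod X G => trace (d i * s v.2^-1%g (u v.1))]
    \in fp_pred (trivial_action gT K) (gprod X G).
Proof.
apply/fp_predP => -[x g] a; rewrite !ffunE /= fpJ -ractM.
by rewrite invMg mulKVg.
Qed.

Definition coordf i X (u : R X) : k (gprod X G) := Fp (coordf_subproof i u).

(** The transfer along X x G -> X sums over all of G; the factor [e], of trace 1, normalises this
    sum. *)
Lemma coordf_dual_basis :
  @dual_basis gT k (kalg_mod R) G r (fun i => reg_elt (e * w i)) coordf.
Proof.
split.
- move=> i X u v; apply: fp_ext => -[x g].
  by rewrite !ffunE rmorphD mulrDr traceD.
- move=> i X a u; apply: fp_ext => -[x g]; rewrite !ffunE /= rmorphM -hJ.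
  by rewrite mulrCA traceZ.
- by move=> i X Y f u; apply: fp_ext => -[x g]; rewrite !ffunE.
- move=> i X Y f u; apply: fp_ext => -[y g]; rewrite !ffunE big_gprodm /=.
  rewrite rmorph_sum mulr_sumr (morphD_sum traceD).
  by apply: eq_bigr => x _; rewrite ffunE.
- move=> X u; apply: fp_ext => x.
  rewrite [LHS]fp_sumE.
  transitivity (\sum_i \sum_g
    (\sum_b s b (d i) * s (g^-1 * b)%g (u x)) * s g (e * w i)).
    apply: eq_bigr => i _; rewrite ffunE big_gfst; apply: eq_bigr => g _.
    rewrite !ffunE traceE; congr (_ * _).
    by apply: eq_bigr => b _; rewrite rmorphM ractM.
  (* For b = g the automorphism is the identity, which leaves [u x] times the trace of [e]. *)
  rewrite (dual_collapse (fun g b => s (g^-1 * b)%g (u x))).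
  by under eq_bigr do rewrite mulVg ract1; rewrite -mulr_suml trace1 mul1r.
Qed.

Theorem fp_flat : flat (kalg_mod R).
Proof. exact: flat_of_dual_basis coordf_dual_basis. Qed.

(** * The box square of FP(L) and the differentials *)

Let S : comPzRingType := {ffun gT -> L}.
Let sS : ring_action gT S := square_action s.

Let hS : {rmorphism K -> S} :=
  GRing.RMorphism.clone K S (@square_inl gT L \o h) _.

Fact square_unitJ a x : hS (trivial_action gT K a x) = sS a (hS x).
Proof. by rewrite [RHS]/= -square_inlJ -hJ. Qed.

Definition fp_square : kalg k := KAlg (FP_map square_unitJ).

Fact fp_square_inlP X (c : k X) :
  FP_map (square_inlJ s) X (kalg_unit R X c) = kalg_unit fp_square X c.
Proof. by apply: fp_ext => x; rewrite !ffunE. Qed.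

Fact fp_square_inrP X (c : k X) :
  FP_map (square_inrJ s) X (kalg_unit R X c) = kalg_unit fp_square X c.
Proof.
apply: fp_ext => x; rewrite !ffunE; apply/ffunP => g.
by rewrite !ffunE -hJ.
Qed.

Fact fp_square_mulP X (c : k X) :
  FP_map (square_mulJ s) X (kalg_unit fp_square X c) = kalg_unit R X c.
Proof. by apply: fp_ext => x; rewrite !ffunE /= /square_mul !ffunE. Qed.

Definition fp_square_inl : kalg_hom R fp_square :=
  @KAlgHom gT k R fp_square (FP_map (square_inlJ s)) fp_square_inlP.
Definition fp_square_inr : kalg_hom R fp_square :=
  @KAlgHom gT k R fp_square (FP_map (square_inrJ s)) fp_square_inrP.
Definition fp_square_mul : kalg_hom fp_square R :=
  @KAlgHom gT k fp_square R (FP_map (square_mulJ s)) fp_square_mulP.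

(* The map induced by trace (d i * _) (x) id on L (x)_K L. *)
Definition square_coord_val i (p : S) g : L :=
  \sum_b s b (d i) * s (g^-1 * b)%g (p (b^-1 * g)%g).

Lemma square_coord_valD i g :
  {morph (fun p => square_coord_val i p g) : p q / p + q}.
Proof.
move=> p q; rewrite -big_split; apply: eq_bigr => b _.
by rewrite ffunE rmorphD mulrDr.
Qed.

Fact square_coord_subproof i X (p : fp_square X) :
  [ffun v : gprod X G => square_coord_val i (p v.1) v.2]
    \in fp_pred s (gprod X G).
Proof.
apply/fp_predP => -[x g] a; rewrite !ffunE /= fpJ rmorph_sum.
rewrite /square_coord_val (reindex_inj (mulIg a)); apply: eq_bigr => b _.
rewrite rmorphM ffunE -!ractM; congr (s _ _ * s _ (p x _)).
  by rewrite !invMg !mulgA mulgV mul1g.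
by rewrite invMg !mulgA mulgV mul1g mulgK.
Qed.

Definition square_coord_fun i X (p : kalg_mod fp_square X) :
  ind (kalg_mod R) G X := Fp (square_coord_subproof i p).

Definition square_coord (i : 'I_r) :
  kmod_hom (kalg_mod fp_square) (ind (kalg_mod R) G).
Proof.
apply: (@KModHom gT k _ _ (square_coord_fun i)).
- by move=> X p q; apply: fp_ext => v; rewrite !ffunE square_coord_valD.
- move=> X c p; apply: fp_ext => -[x g]; rewrite !ffunE /=.
  rewrite mulr_sumr; apply: eq_bigr => b _.
  by rewrite !ffunE rmorphM -hJ mulrCA.
- by move=> X Y f p; apply: fp_ext => v; rewrite !ffunE.
- move=> X Y f p; apply: fp_ext => -[y g].
  rewrite !ffunE big_gprodm /= (morphD_sum (square_coord_valD i g)).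
  by apply: eq_bigr => x _; rewrite ffunE.
Defined.

(** On products of the two embeddings the [square_coord i] restrict to the coordinate pairings, and
    [dual_collapse] recovers an element from its coordinates. *)
Lemma fp_square_box : is_box_alg fp_square_inl fp_square_inr.
Proof.
apply: (box_of_dual_basis coordf_dual_basis (bP := kalg_pairing _ _)
  (theta := square_coord)) => [i X u v|X p].
  apply: fp_ext => -[x g]; rewrite !ffunE /= traceE mulr_suml.
  apply: eq_bigr => b _; rewrite !ffunE !rmorphM -!ractM mulrA.
  by rewrite !mulgA mulgK mulVg ract1.
apply: fp_ext => x; rewrite [LHS]fp_sumE; apply/ffunP => c; rewrite sum_ffunE.
transitivity (\sum_i \sum_g (\sum_b s b (d i) *
    s (g^-1 * b)%g (p x (c * b^-1 * g)%g)) * s g (e * w i)).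
  apply: eq_bigr => i _; rewrite ffunE big_gfst sum_ffunE.
  apply: eq_bigr => g _; rewrite !ffunE mulrC rmorph_sum; congr (_ * _).
  (* [square_inr] applies [s c] to the coordinate; replacing b by b c absorbs it. *)
  rewrite [RHS](reindex_inj (mulIg c)); apply: eq_bigr => b _.
  by rewrite rmorphM -!ractM invMg !mulgA mulgV mul1g.
(* For b = g the argument of [p x] is [c], and the trace of [e] leaves [p x c]. *)
rewrite (dual_collapse (fun g b => s (g^-1 * b)%g (p x (c * b^-1 * g)%g))).
under eq_bigr do rewrite mulVg ract1 mulgKV.
by rewrite -mulr_suml trace1 mul1r.
Qed.

(** Conjugation fixes 1, hence the indicator of the elements other than 1 is invariant. *)
Fact square_idem_subproof (X : gset gT) :
  ([ffun=> [ffun g => (g != 1%g)%:R]] : {ffun X -> S}) \in fp_pred sS X.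
Proof.
apply/fp_predP => x a; rewrite !ffunE; apply/ffunP => g; rewrite !ffunE.
by rewrite rmorph_nat -eq_mulgV1 -{2}[a]mulg1 (inj_eq (mulgI a)).
Qed.

(** A function in the kernel vanishes at 1, so it equals its product with the idempotent indicator
    of the other elements, which itself lies in the kernel. *)
Lemma fp_kahler_zero : kahler_zero R.
Proof.
apply: (kahler_zero_of_gt1 (mu := fp_square_mul) fp_square_box) => [X u|X u|].
- by apply: fp_ext => x; rewrite !ffunE /= /square_mul !ffunE.
- by apply: fp_ext => x; rewrite !ffunE /= /square_mul !ffunE ract1.
move=> X p p0 I [U [f fI]] gen.
(* The idempotent is taken in level G/G, which is an orbit, and restricted to X, which may not be
   one. *)
pose q : fp_square (gunit gT) := Fp (square_idem_subproof (gunit gT)).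
have q0 : tker fp_square_mul q.
  by apply: fp_ext => x; rewrite !ffunE /= /square_mul !ffunE eqxx.
have /fI fqq : I (gunit gT) (q * q).
  by apply/gen/Gt1Mul => //; apply: gunit_orbit.
have -> : p = p * tres (gto_unit X) (q * q).
  apply: fp_ext => x; apply/ffunP => g; rewrite !ffunE.
  case: eqVneq => [->|_]; last by rewrite !mulr1.
  have /(congr1 (fun v : fp s X => v x)) := p0.
  by rewrite !ffunE /= /square_mul => ->; rewrite mul0r.
apply/fI; rewrite /tker tam_homM tam_hom_res fqq.
by rewrite (morphD0 (mresD (tmackey U) _)) mulr0.
Qed.

(** * Generators of FP(L) and the conclusion over rings *)

Fact const_subproof (X : gset gT) (c : K) :
  ([ffun=> c] : {ffun X -> K}) \in fp_pred (trivial_action gT K) X.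
Proof. by apply/fp_predP => x a; rewrite !ffunE. Qed.

Definition constf X (c : K) : k X := Fp (const_subproof X c).

(** At y, the pairs x, g with x g = y contribute g(u x) g(e) = u y g(e). Each g occurs once, so the
    sum over all of X, rather than over orbit representatives, is u y times the trace of [e]. The
    inner sum is [trace_expand] applied to [u x * e]. *)
Lemma fp_generated X (u : R X) :
  u = \sum_x ttr (gorbit x) (\sum_i
    kalg_unit R G (constf G (trace (d i * (u x * e)))) * reg_elt (w i)).
Proof.
apply: fp_ext => y; rewrite [RHS]fp_sumE.
transitivity (\sum_x \sum_(g | gorbit x g == y) u y * s g e).
  rewrite (exchange_big_dep xpredT) //= -[LHS]mulr1 -trace1 mulr_sumr.
  (* For given g, the only point that g sends to y is y g^-1. *)
  apply: eq_bigr => g _; rewrite (big_pred1 (gact X y g^-1%g)) // => x /=.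
  by rewrite -[RHS](inj_eq (act_inj (gact X) g)) actKVin ?inE.
apply: eq_bigr => x _; rewrite ffunE; apply: eq_bigr => g /eqP <-.
rewrite [RHS]fp_sumE /= fpJ -rmorphM -[u x * e in LHS]trace_expand rmorph_sum.
by apply: eq_bigr => i _; rewrite !ffunE rmorphM -hJ.
Qed.

(** The formula of [fp_generated] lifts term by term to the free polynomial algebra on r generators
    in level G/e. *)
Lemma fp_generators_surj
    (gen := PVal (fun i => reg_elt (w i)) : pval k (fun _ => G)) X (u : R X) :
  exists b, free_poly_eval gen X b = u.
Proof.
pose P := free_poly k (fun _ : 'I_r => G).
exists (\sum_x ttr (gorbit x) (\sum_i
  kalg_unit P G (constf G (trace (d i * (u x * e)))) * free_poly_var k _ i)).
rewrite [RHS]fp_generated tam_hom_sum; apply: eq_bigr => x _.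
rewrite tam_hom_tr tam_hom_sum; congr (ttr _ _); apply: eq_bigr => i _.
by rewrite tam_homM kalg_homP (free_poly_evalE gen).
Qed.

Theorem galois_etale :
  formally_etale R /\ (hilbert_basis k -> etale R).
Proof.
have fe : formally_etale R by split; [apply: fp_flat | apply: fp_kahler_zero].
split=> // hk; split=> //.
exact: (hilbert_finitely_presented fp_generators_surj).
Qed.

End GaloisRing.

(** * Galois extensions of fields *)

Section GaloisField.
Variables (gT : finGroupType) (K : fieldType) (L : splittingFieldType K).
Variable phi : {morphism [set: gT] >-> gal_of {:L}}.
Hypothesis galL : galois 1 {:L}.
Hypothesis isoG : isom [set: gT] 'Gal({:L} / 1) phi.
Let s := gal_action phi.

(** Since the extension is Galois, the fixed field of the whole group is the base field. *)
Lemma gal_action_fixed y :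
  (forall a, s a y = y) -> exists c : K, in_alg L c = y.
Proof.
move=> fy; suff /vlineP[c ->] : y \in 1%VS by exists c.
have /galois_fixedField <- := galL; apply/fixedFieldP; first exact: memvf.
move=> x; have /isomP[_ <-] := isoG.
by case/morphimP => a _ _ ->; apply: fy.
Qed.

Lemma gal_iso_mem g : phi g \in 'Gal({:L} / 1)%g.
Proof. by have /isomP[_ <-] := isoG; apply: mem_morphim; rewrite ?inE. Qed.

Lemma gal_iso_inj : injective phi.
Proof.
have /isomP[/injmP phi_inj _] := isoG.
by move=> a b; apply: phi_inj; rewrite inE.
Qed.

(** [gal_matrix] supplies w for which the matrix of the g(w_i) is invertible. *)
Lemma gal_action_dual : exists r (w d : 'I_r -> L),
  forall g, \sum_i s g (w i) * d i = (g == 1%g)%:R.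
Proof.
have [w _ [uM _ _]] := gal_matrix 'Gal({:L} / 1)%g.
set M := (M in M \in unitmx) in uM.
pose rk := enum_rank_in (group1 'Gal({:L} / 1)%g).
(* [d] is the column of the inverse matrix at the identity. *)
exists #|'Gal({:L} / 1)%g|, (tnth w), (fun i => invmx M i (rk 1%g)) => g.
have /matrixP/(_ (rk (phi g)) (rk 1%g)) := mulmxV uM; rewrite !mxE.
under eq_bigr do rewrite mxE enum_rankK_in ?gal_iso_mem //.
move=> ->; congr (_%:R).
rewrite -(inj_eq enum_val_inj) !enum_rankK_in ?group1 ?gal_iso_mem //.
by rewrite -(inj_eq gal_iso_inj) morph1.
Qed.

(** By Dedekind independence of automorphisms the trace is not identically zero. Its values are
    fixed by G, so dividing some y by its nonzero trace gives an element of trace 1. *)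
Lemma gal_action_trace1 : exists e, \sum_g s g e = 1.
Proof.
have [y _ ty] := @gal_independent_contra _ _ {:L} (mem 'Gal({:L} / 1)%g)
  (fun=> 1) 1%g (group1 _) (oner_neq0 L).
have {ty} ty : \sum_g s g y != 0.
  have /isomP[_ imphi] := isoG.
  move: ty; rewrite -imphi morphimEdom big_imset /=; last first.
    by move=> a b _ _; apply: gal_iso_inj.
  by rewrite (eq_bigl _ _ (in_setT (T := gT))); under eq_bigr do rewrite mul1r.
exists (y / \sum_g s g y).
under eq_bigr do rewrite rmorphM fmorphV trace_fixed.
by rewrite -mulr_suml divff.
Qed.

End GaloisField.

Theorem corollary6 (gT : finGroupType) (K : fieldType)
    (L : splittingFieldType K)
    (phi : {morphism [set: gT] >-> gal_of {:L}})
    (galL : galois 1 {:L})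
    (isoG : isom [set: gT] 'Gal({:L} / 1) phi) :
  formally_etale (FP_ext phi) /\
  (hilbert_basis (constT gT K) -> etale (FP_ext phi)).
Proof.
have [r [w [d dualP]]] := gal_action_dual isoG.
have [e e1] := gal_action_trace1 isoG.
exact: (galois_etale (in_alg_equivariant phi) (fmorph_inj _)
  (gal_action_fixed galL isoG) dualP e1).
Qed.
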